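(* Let $u,e\in C_6$ be two unitary elements. Then $$\operatorname{dt}u=\operatorname{dt}_{e}u\cdot\operatorname{dt}e.$$
   Context: Cayley–Dickson algebras: $\mathcal A_0=\mathbb C$ with its usual product, $x^{\diamond}=x$, $x^*=\overline{x}$. Inductively $\mathcal A_{n+1}=\mathcal A_n\times\mathcal A_n$ with $\overline{(x_1,x_2)}=(\overline{x_1},\overline{x_2})$, $(x_1,x_2)^{\diamond}=(x_1^{\diamond},-x_2)$, $(x_1,x_2)^*=(x_1^*,-\overline{x_2})$ and $(x_1,x_2)\boxdot(y_1,y_2)=(x_1\boxdot y_1-y_2\boxdot x_2^{\diamond},\ x_1^{\diamond}\boxdot y_2+y_1\boxdot x_2)$. Complex octonions: $\mathbb O=\mathcal A_3$; $a\in\mathcal A_n$ is identified with $(a,0)\in\mathcal A_{n+1}$. For matrices over $\mathbb O$: $(x^\diamond)_{ij}=(x_{ji})^\diamond$, $(x^* )_{ij}=(x_{ji})^*$, and $\boxdot$ is the usual matrix product. The Cartan factor of type 6 is the JB$^*$-algebra $C_6=H_3(\mathbb O)=\{x\in M_3(\mathbb O): x^{\diamond}=x\}$ with Jordan product $x\circ y=\frac12(x\boxdot y+y\boxdot x)$, involution $^*$ and unit the unit matrix $\mathbf 1$. It has the triple product $\{x,y,z\}=(x\circ y^* )\circ z+(z\circ y^* )\circ x-(x\circ z)\circ y^*$. An element $u\in C_6$ is unitary if $\{u,u,x\}=x$ for all $x\in C_6$. A tripotent is $v$ with $\{v,v,v\}=v$; it is minimal if $\{x:\{v,v,x\}=x\}=\mathbb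 C v\neq\{0\}$. Tripotents $v,w$ are orthogonal if $\{v,v,w\}=0$; $v\le w$ means that $w-v$ is a tripotent orthogonal to $v$. For unitary $u,e\in C_6$ one can write $u=\alpha_1v_1+\alpha_2v_2+\alpha_3v_3$ with complex numbers $\alpha_j$ of modulus one and mutually orthogonal minimal tripotents $v_j\le e$; the triple $(\alpha_1,\alpha_2,\alpha_3)$ is unique up to reordering, and $\operatorname{dt}_e u:=\alpha_1\alpha_2\alpha_3$. Further $\operatorname{dt}u:=\operatorname{dt}_{\mathbf 1}u$ (in this case the $v_j$ are mutually orthogonal minimal projections). *)

(* Defs.v *)
From HB Require Import structures.
From mathcomp Require Import all_boot all_order all_algebra.
From mathcomp Require Import complex.
From mathcomp Require Import boolp classical_sets reals.

Set Implicit Arguments.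
Unset Strict Implicit.
Unset Printing Implicit Defensive.

Import Order.TTheory GRing.Theory Num.Theory.
Local Open Scope classical_set_scope.
Local Open Scope ring_scope.

(** * Complex Cayley-Dickson algebras *)

(** Only the complex vector space structure is canonical; the product
    [cd_mul] is not associative for [3 <= n]. *)
Fixpoint CD (R : realType) (n : nat) : lmodType R[i] :=
  if n is m.+1 then (CD R m * CD R m)%type else R[i]^o.

Section CayleyDickson.
Variable R : realType.

(** [a : CD R n] is identified with [(a, 0) : CD R n.+1], so the unit is
    [(1, 0, ..., 0)]. *)
Fixpoint cd_one (n : nat) : CD R n :=
  match n return CD R n with
  | 0 => (1 : R[i])
  | m.+1 => (cd_one m, 0)
  end.

Fixpoint cd_bar (n : nat) : CD R n -> CD R n :=
  match n return CD R n -> CD R n with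
  | 0 => fun x : R[i] => Num.conj x
  | m.+1 => fun x => (cd_bar x.1, cd_bar x.2)
  end.

Fixpoint cd_diam (n : nat) : CD R n -> CD R n :=
  match n return CD R n -> CD R n with
  | 0 => fun x => x
  | m.+1 => fun x => (cd_diam x.1, - x.2)
  end.

Fixpoint cd_star (n : nat) : CD R n -> CD R n :=
  match n return CD R n -> CD R n with
  | 0 => fun x : R[i] => Num.conj x
  | m.+1 => fun x => (cd_star x.1, - cd_bar x.2)
  end.

Fixpoint cd_mul (n : nat) : CD R n -> CD R n -> CD R n :=
  match n return CD R n -> CD R n -> CD R n with
  | 0 => fun x y : R[i] => x * y
  | m.+1 => fun x y =>
      (cd_mul x.1 y.1 - cd_mul y.2 (cd_diam x.2),
       cd_mul (cd_diam x.1) y.2 + cd_mul y.1 x.2)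
  end.

End CayleyDickson.

Definition octonion (R : realType) := CD R 3.

(** * The Cartan factor of type 6 *)

Section CartanFactor6.
Variable R : realType.
Local Notation M := 'M[octonion R]_3.
Implicit Types (x y z u e v w : M) (a : R[i]).

(** MathComp's [*m] and [*:] on matrices need entries in an associative ring,
    hence the explicit product and scalar multiplication below. *)
Definition omx_mul x y : M := \matrix_(i, j) \sum_k cd_mul (x i k) (y k j).
Definition omx_scale a x : M := map_mx (fun t : octonion R => a *: t) x.
Definition omx_one : M := \matrix_(i, j) if i == j then cd_one R 3 else 0.
Definition omx_diam x : M := \matrix_(i, j) cd_diam (x j i).
Definition omx_star x : M := \matrix_(i, j) cd_star (x j i).

Definition C6 : set M := [set x | omx_diam x = x].

Definition jordan x y : M := omx_scale 2^-1 (omx_mul x y + omx_mul y x).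

Definition triple x y z : M :=
  jordan (jordan x (omx_star y)) z + jordan (jordan z (omx_star y)) x
  - jordan (jordan x z) (omx_star y).

Definition unitary u : Prop :=
  C6 u /\ forall x, C6 x -> triple u u x = x.

Definition tripotent v : Prop := C6 v /\ triple v v v = v.

Definition minimal_tripotent v : Prop :=
  [/\ tripotent v,
      [set x | C6 x /\ triple v v x = x] = [set omx_scale a v | a in [set: R[i]]]
    & [set omx_scale a v | a in [set: R[i]]] <> [set 0]].

Definition orthogonal v w : Prop := triple v v w = 0.

Definition tripotent_le v w : Prop :=
  tripotent (w - v) /\ orthogonal (w - v) v.

(** * The determinant *)

Definition dt_decomposition e u (alpha : 'I_3 -> R[i]) (v : 'I_3 -> M) : Prop :=
  [/\ forall j, `|alpha j| = 1,
      forall j, minimal_tripotent (v j),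
      forall j k, j != k -> orthogonal (v j) (v k),
      forall j, tripotent_le (v j) e
    & u = \sum_j omx_scale (alpha j) (v j)].

(** For unitary [e] and [u] a decomposition exists and its coefficients are
    unique up to order, so [xget] returns their product; the default value [0]
    only occurs for other arguments. *)
Definition dt_rel e u : R[i] :=
  xget 0 [set d | exists (alpha : 'I_3 -> R[i]) (v : 'I_3 -> M),
                    dt_decomposition e u alpha v /\ d = \prod_j alpha j].

Definition dt u : R[i] := dt_rel omx_one u.

End CartanFactor6.

(* Main.v *)
(* The Albert algebra is handled through its Hermitian inner product [ip] and the
   conjugate-linear Freudenthal product [x ** y = (x # y)^*], in terms of which
   2{x,y,z} = <x,y> z + <z,y> x - (x ** z) ** y and 6 det x = <x, x ** x>; no unit is involved.
   All identities come from the quartic one x## = det(x) x.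
   An element u is unitary iff u ** u = 2 l u with |l| = 1, and then det u is the conjugate of l.
   If u = a1 v1 + a2 v2 + a3 v3 with orthogonal nonzero tripotents vj <= e, then each vj has
   rank one (vj ** vj = 0), e = v1 + v2 + v3, and expanding the cubic form gives
   det u = a1 a2 a3 det e. Hence dt_e u = det u / det e, and the theorem is the chain rule for
   quotients. Existence of the decomposition: for a root a of det(u - t e) and w = u - a e,
   the rank one element w ** w (or w, if w ** w = 0) splits off a common minimal tripotent of
   u and e, and the remaining part lives in a spin factor, where it is split by hand. *)

Require Import Defs.
From mathcomp Require Import all_boot all_order all_algebra.
From mathcomp Require Import complex ring.
From mathcomp Require Import boolp classical_sets reals.

Set Implicit Arguments.
Unset Strict Implicit.
Unset Printing Implicit Defensive.

Import Order.TTheory GRing.Theory Num.Theory.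
Local Open Scope classical_set_scope.
Local Open Scope ring_scope.

(** A decomposition in [dt_rel] is relative to [e], but the determinant knows nothing of [e]:
    written through [ip] and [**], the triple product treats all unitary elements alike, so one
    cubic form serves both [omx_one] and [e], without passing to an isotope. As [dt_rel] is a choice
    with default 0, uniqueness and existence both need proof. Uniqueness is immediate, because every
    decomposition yields the same quotient of determinants. Existence is the long half. Octonion
    matrices offer no usable eigenvectors; the substitute is that a singular w has an adjoint of
    rank at most one, like the adjugate of a singular matrix. This gives nothing when u is a
    multiple of e, since then w = 0, and another unitary element built from the diagonal idempotents
    takes the place of u. Normalisation: [x ** x] is twice the conjugated adjoint and
    [ip x (x ** x)] is six times the determinant; the factor cancels in quotients. *)

(* Since [bx] is conjugate-linear in both arguments, [ip x (bx y z)] is trilinear: it is the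
   polarized cubic norm. *)
Record hcubic (C : numClosedFieldType) (V : lmodType C) := HCubic {
  ip : V -> V -> C;
  bx : V -> V -> V;
  ipDl : forall x y z, ip (x + y) z = ip x z + ip y z;
  ipZl : forall a x y, ip (a *: x) y = a * ip x y;
  ipC : forall x y, (ip x y)^* = ip y x;
  ip_ge0 : forall x, 0 <= ip x x;
  ip_eq0 : forall x, ip x x = 0 -> x = 0;
  bxC : forall x y, bx x y = bx y x;
  bxDl : forall x y z, bx (x + y) z = bx x z + bx y z;
  bxZl : forall a x y, bx (a *: x) y = a^* *: bx x y;
  ip_bx : forall x y z, ip x (bx y z) = ip y (bx z x);
  quartic : forall x, 3 *: bx (bx x x) (bx x x) = (4 * ip x (bx x x)) *: x }.

(** This linearises [quartic]: the difference of its two sides, paired with a fixed vector, comes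
    from such a form. *)
Lemma polar4 (V : zmodType) (C : numFieldType) (f : V -> V -> V -> V -> C) :
  (forall x x' y z t, f (x + x') y z t = f x y z t + f x' y z t) ->
  (forall x y z t, f x y z t = f y x z t) ->
  (forall x y z t, f x y z t = f x z y t) ->
  (forall x y z t, f x y z t = f x y t z) ->
  (forall x, f x x x x = 0) -> forall x y z t, f x y z t = 0.
Proof.
move=> D1 s12 s23 s34 f0.
have D2 x y y' z t : f x (y + y') z t = f x y z t + f x y' z t.
  by rewrite s12 D1 !(s12 _ x).
have D3 x y z z' t : f x y (z + z') t = f x y z t + f x y z' t.
  by rewrite s23 D2 !(s23 x _ y).
have D4 x y z t t' : f x y z (t + t') = f x y z t + f x y z t'.
  by rewrite s34 D3 !(s34 x y _ z).
have N1 x y z t : f (- x) y z t = - f x y z t.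
  have z0 : f 0 y z t = 0 by apply: (addrI (f 0 y z t)); rewrite -D1 !addr0.
  by apply: (addrI (f x y z t)); rewrite -D1 !subrr z0.
have N2 x y z t : f x (- y) z t = - f x y z t by rewrite s12 N1 s12.
have N3 x y z t : f x y (- z) t = - f x y z t by rewrite s23 N2 s23.
have N4 x y z t : f x y z (- t) = - f x y z t by rewrite s34 N3 s34.
have two0 (a : C) : a + a = 0 -> a = 0.
  by move=> /eqP; rewrite -mulr2n mulrn_eq0 => /eqP.
have H2 x y : f x x y y = 0.
  (* In the sum of the two expansions the terms of odd degree in [y] cancel; the six mixed terms
     agree by symmetry, which leaves 12 [f x x y y]. *)
  have := f0 (x + y); have := f0 (x - y).
  rewrite !(D1, D2, D3, D4, N1, N2, N3, N4) !f0 !opprK.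
  have -> : f x y x y = f x x y y by rewrite s23.
  have -> : f x y y x = f x x y y by rewrite s34 s23.
  have -> : f y x x y = f x x y y by rewrite s12 s23.
  have -> : f y x y x = f x x y y by rewrite s12 s34 s23.
  have -> : f y y x x = f x x y y by rewrite s23 s12 s34 s23.
  move=> E1 E2; have := congr2 +%R E1 E2; rewrite [RHS]addr0 => E.
  have /eqP : 12 * f x x y y = 0 by rewrite -[RHS]E; ring.
  by rewrite mulf_eq0 pnatr_eq0 => /eqP.
have H3 x y z : f x x y z = 0.
  apply: two0; have := H2 x (y + z).
  by rewrite !(D3, D4) !H2 add0r addr0 (s34 x x z y).
move=> x y z t; apply: two0; have := H3 (x + y) z t.
by rewrite !(D1, D2) !H3 add0r addr0 (s12 y x).
Qed.

(** * Hermitian cubic spaces *)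

Section HermitianCubic.
Variables (C : numClosedFieldType) (V : lmodType C) (H : hcubic V).
Local Notation "x ** y" := (bx H x y) (at level 38, left associativity).
Local Notation ip := (ip H).
Implicit Types (x y z t s u v w e f g r : V) (a b c l m : C).

Lemma ipNl x y : ip (- x) y = - ip x y.
Proof. by rewrite -scaleN1r ipZl mulN1r. Qed.
Lemma ip0l y : ip 0 y = 0.
Proof. by rewrite -(scale0r 0) ipZl mul0r. Qed.
Lemma ipDr x y z : ip z (x + y) = ip z x + ip z y.
Proof. by rewrite -ipC ipDl rmorphD /= !ipC. Qed.
Lemma ipZr a x y : ip y (a *: x) = a^* * ip y x.
Proof. by rewrite -ipC ipZl rmorphM /= ipC. Qed.
Lemma ipNr x y : ip y (- x) = - ip y x.
Proof. by rewrite -ipC ipNl rmorphN /= ipC. Qed.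
Lemma ip0r y : ip y 0 = 0.
Proof. by rewrite -ipC ip0l rmorph0. Qed.
Definition ipEl := (ipDl, ipZl, ipNl, ip0l).
Definition ipE := (ipDl, ipZl, ipNl, ip0l, ipDr, ipZr, ipNr, ip0r).
Lemma ip_ext x y : (forall z, ip x z = ip y z) -> x = y.
Proof.
move=> E; apply/eqP; rewrite -subr_eq0; apply/eqP.
by apply: (ip_eq0 (h := H)); rewrite !ipEl E subrr.
Qed.
Lemma bxDr x y z : z ** (x + y) = z ** x + z ** y.
Proof. by rewrite bxC bxDl !(bxC H z). Qed.
Lemma bxZr a x y : y ** (a *: x) = a^* *: (y ** x).
Proof. by rewrite bxC bxZl bxC. Qed.
Lemma bxNl x y : - x ** y = - (x ** y).
Proof. by rewrite -scaleN1r bxZl rmorphN1 scaleN1r. Qed.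
Lemma bxNr x y : y ** - x = - (y ** x).
Proof. by rewrite bxC bxNl bxC. Qed.
Lemma bx0l y : 0 ** y = 0.
Proof. by rewrite -(scale0r 0) bxZl rmorph0 !scale0r. Qed.
Lemma bx0r y : y ** 0 = 0.
Proof. by rewrite bxC bx0l. Qed.
Definition bxE := (bxDl, bxZl, bxNl, bx0l, bxDr, bxZr, bxNr, bx0r).

Lemma ip_bxC x y z : ip x (y ** z) = ip y (x ** z).
Proof. by rewrite ip_bx bxC. Qed.

(** The factors 3 and 4 of [quartic] count the pairings of four arguments and the choices of one
    among them. *)
Lemma quartic_polar x y z t :
  (x ** y) ** (z ** t) + (x ** z) ** (y ** t) + (x ** t) ** (y ** z) =
  ip x (y ** z) *: t + ip x (y ** t) *: z + ip x (z ** t) *: y + ip y (z ** t) *: x.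
Proof.
apply: ip_ext => s; apply/eqP; rewrite -subr_eq0; apply/eqP.
move: x y z t.
pose f x y z t := 
  ip ((x ** y) ** (z ** t) + (x ** z) ** (y ** t) + (x ** t) ** (y ** z)) s -
  ip (ip x (y ** z) *: t + ip x (y ** t) *: z + ip x (z ** t) *: y + ip y (z ** t) *: x) s.
apply: (polar4 (f := f)) => [x x' y z t|x y z t|x y z t|x y z t|x]; rewrite /f.
- rewrite !bxE !ipEl; ring.
- rewrite !ipEl (bxC H y x). rewrite (bxC H (y ** z)) (bxC H (y ** t)).
  rewrite !(ip_bxC y x); ring.
- rewrite !ipEl (bxC H z y) (ip_bxC z y) ; ring.
- rewrite !ipEl (bxC H t z); ring.
- have := congr1 (ip ^~ s) (quartic H x); rewrite /= !ipEl => E.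
  set A := ip (x ** x ** _) s in E *.
  have E3 : forall k : C, k + k + k = 3 * k by move=> k; ring.
  rewrite E3 E; ring.
Qed.

(* The adjoint of [quartic_polar] with respect to [ip]. *)
Lemma quartic_dual s x y z :
  z ** (s ** (x ** y)) + y ** (s ** (x ** z)) + x ** (s ** (y ** z)) =
  (ip x (y ** z))^* *: s + ip s z *: (x ** y) + ip s y *: (x ** z) + ip s x *: (y ** z).
Proof.
have dual u v w : ip v (u ** (s ** w)) = (ip s (w ** (u ** v)))^*.
  by rewrite ip_bx ip_bx -ipC ip_bx (bxC H v u).
apply: ip_ext => t; rewrite -ipC -[RHS]ipC; congr (_^*).
rewrite !ipDr !dual -!rmorphD /=.
have /(congr1 (ip s)) := quartic_polar x y z t.
rewrite !ipDr !ipZr => E.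
rewrite (bxC H (y ** z)) E !rmorphD !rmorphM /= !conjCK !ipC.
rewrite (ip_bx H t x y) (ip_bx H t x z) (ip_bx H t y z); ring.
Qed.

(** Pairing with an arbitrary [s] turns a consequence of a vector equation into a scalar identity
    for [ring]; [a] is the factor applied to the known equation. *)
Lemma lin_comb a x y z t : z = t ->
  (forall s, ip x s - ip y s = a * (ip z s - ip t s)) -> x = y.
Proof.
move=> E D; apply: ip_ext => s; apply/eqP; rewrite -subr_eq0 D E subrr.
by rewrite mulr0.
Qed.

Definition tripl x y z : V := 2^-1 *: (ip x y *: z + ip z y *: x - x ** z ** y).

Lemma tripl_eq x y z w :
  tripl x y z = w <-> ip x y *: z + ip z y *: x - x ** z ** y = 2 *: w.
Proof.
split; first by rewrite /tripl => <-; rewrite scalerA divff ?pnatr_eq0 // scale1r.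
by rewrite /tripl => ->; rewrite scalerA mulVf ?pnatr_eq0 // scale1r.
Qed.

Lemma scale_inj a x y : a != 0 -> a *: x = a *: y -> x = y.
Proof. by move=> a0 E; rewrite -(scale1r x) -(mulVf a0) -scalerA E scalerA mulVf // scale1r. Qed.

Lemma scale_eq0 a x : x != 0 -> a *: x = 0 -> a = 0.
Proof. by move=> x0 /eqP; rewrite scaler_eq0 (negPf x0) orbF => /eqP. Qed.

Lemma ip_neq0 x : x != 0 -> ip x x != 0.
Proof. by apply: contraNneq => /ip_eq0 ->. Qed.

(** The case det x = 0 of the quartic identity: the adjoint of a singular element has rank at most
    one. *)
Lemma adjoint_adjoint x : ip x (x ** x) = 0 -> x ** x ** (x ** x) = 0.
Proof.
move=> E; apply: (@scale_inj 3); first by rewrite pnatr_eq0.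
by rewrite quartic E mulr0 scale0r scaler0.
Qed.

Lemma bx_cube x y :
  3 *: (x ** x ** (x ** y)) = ip x (x ** x) *: y + (3 * ip y (x ** x)) *: x.
Proof.
have := quartic_polar x x x y; set u := _ ** (x ** y).
rewrite (bxC H (x ** y)) -/u (ip_bx H y) => E.
have -> : 3 *: u = u + u + u by apply: ip_ext => z; rewrite !ipEl; ring.
by rewrite E; apply: ip_ext => z; rewrite !ipEl; ring.
Qed.

(** * Rank one elements and their Peirce-0 spaces *)

Section RankOne.
Variable r : V.
Hypothesis rr : r ** r = 0.

Lemma rank1_ipr y : ip r (r ** y) = 0.
Proof. by rewrite ip_bx bxC -ip_bx rr ip0r. Qed.
Lemma rank1_ipl y : ip (r ** y) r = 0.
Proof. by rewrite -ipC rank1_ipr rmorph0. Qed.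

(** In [quartic_dual] at [s], [r], [r], [y] the terms with [r ** r] or [ip r (r ** y)] drop out. For
    [s = r] the result places every [r ** y] in the Peirce-0 space of [r]. *)
Lemma rank1_bx3 s y : r ** (s ** (r ** y)) = ip s r *: (r ** y).
Proof.
have := quartic_dual s r r y; rewrite rr rank1_ipr !bxE add0r rmorph0 scale0r add0r
  scaler0 add0r => E.
apply: (@scale_inj 2); first by rewrite pnatr_eq0.
have tw z : 2 *: z = z + z by rewrite scaler_nat mulr2n.
by rewrite !tw.
Qed.

Lemma rank1_bxbx x y : r ** x ** (r ** y) = ip r (x ** y) *: r.
Proof.
have := quartic_polar r r x y.
rewrite rr !rank1_ipr !bxE !scale0r !add0r (bxC H (r ** y)) => E.
apply: (@scale_inj 2); first by rewrite pnatr_eq0.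
have tw z : 2 *: z = z + z by rewrite scaler_nat mulr2n.
by rewrite !tw.
Qed.
End RankOne.

(* This is the Peirce-0 space of [r] only when [r ** r = 0]. *)
Definition peirce0 r y := r ** (r ** y) = ip r r *: y.

Lemma peirce0D r x y : peirce0 r x -> peirce0 r y -> peirce0 r (x + y).
Proof. by rewrite /peirce0 !bxE scalerDr => -> ->. Qed.
Lemma peirce0Z r a y : peirce0 r y -> peirce0 r (a *: y).
Proof. by rewrite /peirce0 !bxE conjCK => ->; rewrite !scalerA mulrC. Qed.
Lemma peirce0N r y : peirce0 r y -> peirce0 r (- y).
Proof. by rewrite -scaleN1r; apply: peirce0Z. Qed.
Lemma peirce0B r x y : peirce0 r x -> peirce0 r y -> peirce0 r (x - y).
Proof. by move=> ? /peirce0N; apply: peirce0D. Qed.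
Lemma peirce0_0 r : peirce0 r 0.
Proof. by rewrite /peirce0 !bx0r scaler0. Qed.
Lemma peirce0_bx r y : r ** r = 0 -> peirce0 r (r ** y).
Proof. by move=> rr; rewrite /peirce0 rank1_bx3. Qed.

Section Peirce0.
Variable r : V.
Hypotheses (rr : r ** r = 0) (r0 : r != 0).

Lemma peirce0_scale a y : a != 0 -> peirce0 r y -> peirce0 (a *: r) y.
Proof.
rewrite /peirce0 !bxE !ipE conjCK => a0 ->.
by rewrite !scalerA; congr (_ *: _); ring.
Qed.

Lemma peirce0_ip y : peirce0 r y -> ip y r = 0.
Proof.
move=> Zy; apply/eqP; have := rank1_ipl rr (r ** y); rewrite Zy ipZl => /eqP.
by rewrite mulf_eq0 (negPf (ip_neq0 r0)).
Qed.

(** A Peirce-0 vector is itself of the form [r ** x], and by [rank1_bxbx] products of such vectors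
    lie on the line of [r]. *)
Lemma peirce0_rank1 y : peirce0 r y -> exists a, y ** y = a *: r.
Proof.
move=> Zy; exists ((ip r r)^-1 ^+ 2 * ip r (r ** y ** (r ** y))).
have n0 := ip_neq0 r0.
have Ey : y = (ip r r)^-1 *: (r ** (r ** y)) by rewrite Zy scalerA mulVf // scale1r.
rewrite {1 2}Ey !bxE rank1_bxbx // !scalerA fmorphV /= ipC.
by congr (_ *: _); ring.
Qed.

(** The coefficient [a] cannot vanish: otherwise [r] would lie in its own Peirce-0 space, against
    [peirce0_ip]. *)
Lemma peirce0_solve e a c : c != 0 -> peirce0 r (a *: e + c *: r) ->
  exists b, peirce0 r (e - b *: r).
Proof.
move=> c0 Z0; have [a0 | a0] := eqVneq a 0.
  move: (peirce0_ip Z0); rewrite a0 scale0r add0r ipZl => /eqP.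
  by rewrite mulf_eq0 (negPf c0) (negPf (ip_neq0 r0)).
exists (- (a^-1 * c)); have := peirce0Z a^-1 Z0.
by rewrite scalerDr !scalerA mulVf // scale1r scaleNr opprK.
Qed.
End Peirce0.

(** For [r] of rank one, [r ** e] lies in the Peirce-0 space of [r], so writing it as a combination
    of [w], [e] and [r] splits [e] along [r]. The last two hypotheses are these expressions for
    [r = w] and [r = w ** w]. *)
Lemma pencil_rank1 e w :
  w != 0 -> ip w (w ** w) = 0 ->
  (w ** w = 0 -> exists a b, a != 0 /\ w ** e = a *: w + b *: e) ->
  (exists a b c, c != 0 /\ w ** w ** e = a *: w + b *: e + c *: (w ** w)) ->
  exists r a b, [/\ r != 0, r ** r = 0, peirce0 r (e - a *: r) & peirce0 r (w - b *: r)].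
Proof.
move=> w0 Dw P1 P2; have [ww | ww] := eqVneq (w ** w) 0.
  have [a [b [a0 E]]] := P1 ww.
  have := peirce0_bx e ww; rewrite E addrC => Z.
  have [c Zc] := peirce0_solve ww w0 a0 Z.
  by exists w, c, 1; split=> //; rewrite scale1r subrr; apply: peirce0_0.
have rr := adjoint_adjoint Dw.
(* This is [bx_cube] with second argument [w ** w], where the determinant term vanishes. *)
have Zw : peirce0 (w ** w) w.
  apply: (@scale_inj 3); first by rewrite pnatr_eq0.
  rewrite (bxC H _ w) bx_cube Dw scale0r add0r scalerA; congr (_ *: _).
have [a [b [c [c0 E]]]] := P2.
have := peirce0_bx e rr; rewrite E -addrA => Z.
have := peirce0B Z (peirce0Z a Zw); rewrite [a *: w + _]addrC addrK => {}Z.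
have [d Zd] := peirce0_solve rr ww c0 Z.
by exists (w ** w), d, 0; split=> //; rewrite scale0r subr0.
Qed.

(** * Frames, and the equations of unitary elements *)

Definition frame l v1 v2 v3 :=
  [/\ [/\ v1 ** v1 = 0, v2 ** v2 = 0 & v3 ** v3 = 0],
      [/\ ip v1 v1 = 1, ip v2 v2 = 1 & ip v3 v3 = 1],
      [/\ ip v1 v2 = 0, ip v2 v3 = 0 & ip v3 v1 = 0]
    & [/\ v1 ** v2 = l *: v3, v2 ** v3 = l *: v1 & v3 ** v1 = l *: v2]].

(* [l] is the conjugate of the determinant of [u]. *)
Definition phased_unitary l u :=
  [/\ l * l^* = 1, u ** u = (2 * l) *: u, ip u u = 3
    & forall x, u ** x ** u = x + ip x u *: u].

Lemma ip_sym0 x y : ip x y = 0 -> ip y x = 0.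
Proof. by move=> E; rewrite -ipC E rmorph0. Qed.

Lemma ip_adj x u : ip x (u ** x ** u) = ip (u ** x) (u ** x).
Proof. by rewrite ip_bx. Qed.

Section WithFrame.
Variables E1 E2 E3 : V.
Hypothesis HE : frame 1 E1 E2 E3.
Hypothesis HE0 : forall v, v ** E1 = 0 -> v ** E2 = 0 -> v ** E3 = 0 -> v = 0.

Lemma frame_neq0 l v1 v2 v3 : frame l v1 v2 v3 -> [/\ v1 != 0, v2 != 0 & v3 != 0].
Proof.
have nz v : ip v v = 1 -> v != 0.
  by move=> n; apply/eqP => E; move: n; rewrite E ip0l => /esym/eqP; rewrite oner_eq0.
by case=> _ [n1 n2 n3] _ _; split; apply: nz.
Qed.

(** Taking [x = u] and [x = u ** u] in the hypothesis makes [u ** u] a multiple of [u]. Comparison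
    with [quartic] leaves two cases: [ip u u = 3], or [u ** u = 0] with [ip u u = 1]. In the second
    the whole space would be the line of [u], which the frame excludes. *)
Lemma unitary_phased u : (forall x, tripl u u x = x) -> exists l, phased_unitary l u.
Proof.
move=> hu; set s := ip u u.
have hU x : u ** x ** u = (s - 2) *: x + ip x u *: u.
  have /tripl_eq E := hu x.
  by apply: (lin_comb (a := -1) E) => z; rewrite !ipEl -/s; ring.
have [E10 _ _] := frame_neq0 HE.
have u0 : u != 0.
  apply: contra_neq E10 => u0; have := hU E1.
  rewrite /s u0 !(ip0l,ip0r,bxE,scale0r,scaler0) addr0 sub0r => /esym/eqP.
  by rewrite scaleNr oppr_eq0 scaler_eq0 pnatr_eq0 => /eqP.
have s0 : s != 0 by apply: ip_neq0.
have sR : s^* = s by rewrite ipC.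
have A : u ** u ** u = (2 * (s - 1)) *: u.
  by rewrite hU -/s -scalerDl; congr (_ *: _); ring.
pose D := ip u (u ** u).
have B : u ** u = (D^* / s) *: u.
  have := hU (u ** u); rewrite (bxC H u (u ** u)) A bxZl.
  rewrite rmorphM rmorphB /= sR rmorph1 rmorph_nat -ipC -/D => E.
  apply: (scale_inj s0); rewrite scalerA mulrC divfK //.
  by apply: (lin_comb (a := 1) E) => z; rewrite !ipEl; ring.
pose l := D^* / (2 * s).
have two0 : 2 != 0 :> C by rewrite pnatr_eq0.
have Bl : u ** u = (2 * l) *: u by rewrite B; congr (_ *: _); rewrite /l; field; rewrite s0.
have L1 : 2 * (l * l^*) = s - 1.
  have := A; rewrite Bl bxZl Bl scalerA rmorphM rmorph_nat => /eqP.
  rewrite -subr_eq0 -scalerBl => /eqP/(scale_eq0 u0) E; apply: (mulfI two0).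
  by apply/eqP; rewrite -subr_eq0 -E; apply/eqP; ring.
have L2 : l^* * (3 * (l * l^*) - s) = 0.
  have := quartic H u; rewrite Bl !bxE Bl !ipE !scalerA !rmorphM !rmorph_nat => /eqP.
  rewrite -subr_eq0 -scalerBl => /eqP/(scale_eq0 u0) E.
  have e0 : 8 != 0 :> C by rewrite pnatr_eq0.
  by apply: (mulfI e0); rewrite mulr0 -E -/s; ring.
have {L2} [l0|L2] : l = 0 \/ 3 * (l * l^*) = s.
  move/eqP: L2; rewrite mulf_eq0 conjC_eq0 subr_eq0 => /orP [] /eqP; by [left | right].
- have s1 : s = 1 by apply/eqP; rewrite -subr_eq0 -L1 l0 mul0r mulr0.
  (* For [x] orthogonal to [u] one has [u ** x ** u = - x], while pairing with [x] gives the square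
     norm of [u ** x]; hence [ip x x <= 0]. *)
  have perp x : ip x u = 0 -> x = 0.
    move=> xu; apply: (ip_eq0 (h := H)); apply/eqP; rewrite eq_le ip_ge0 andbT -oppr_ge0.
    have := ip_ge0 H (u ** x); rewrite -ip_adj hU xu scale0r addr0 s1 ipZr.
    by rewrite rmorphB rmorph1 rmorph_nat (_ : 1 - 2 = -1) ?mulN1r //; ring.
  pose E := E1 + E2 + E3.
  have Eu : E = ip E u *: u.
    by apply/eqP; rewrite -subr_eq0; apply/eqP/perp; rewrite !ipEl -/s s1 -!ipEl; ring.
  have EE : E ** E = 0 by rewrite Eu !bxE Bl l0 mulr0 scale0r !scaler0.
  case: HE => [[h1 h2 h3]] [n1 n2 n3] [o1 o2 o3] [p1 p2 p3].
  have := congr1 (ip E1) EE; rewrite /E !bxE h1 h2 h3.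
  rewrite (bxC H E2 E1) (bxC H E3 E2) (bxC H E1 E3) p1 p2 p3.
  by rewrite !ipE n1 o1 (ip_sym0 o3) rmorph1 => /eqP;
    rewrite !(mulr0, add0r, addr0, mulr1) (_ : 1 + 1 = 2%:R) ?pnatr_eq0.
have ll : l * l^* = 1.
  have -> : l * l^* = 3 * (l * l^*) - 2 * (l * l^*) by ring.
  by rewrite L1 L2; ring.
have s3 : s = 3 by rewrite -L2 ll mulr1.
exists l; split=> // x; rewrite hU s3 (_ : 3 - 2 = 1) ?scale1r //; ring.
Qed.

Lemma phased_neq0 l u : phased_unitary l u -> l != 0 /\ u != 0.
Proof.
case=> ll _ n _; split.
  by apply/eqP => E; move: ll; rewrite E mul0r => /eqP; rewrite eq_sym oner_eq0.
by apply/eqP => E; move: n; rewrite E ip0l => /eqP; rewrite eq_sym pnatr_eq0.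
Qed.

Lemma phased_det l u : phased_unitary l u -> ip u (u ** u) = 6 * l^*.
Proof. case=> _ uu n _; rewrite uu ipZr n rmorphM rmorph_nat; ring. Qed.

(** In [u ** u], the part 2 [v ** f] lies in the Peirce-0 space and [f ** f] on the line of [v].
    These are orthogonal, so both components can be compared with those of 2 l u. Applying [v ** _]
    twice to [f] then fixes the norm of [v]. *)
Lemma phased_peirce l u v f : phased_unitary l u -> v ** v = 0 -> v != 0 ->
  u = v + f -> peirce0 v f -> [/\ ip v v = 1, v ** f = l *: f & f ** f = (2 * l) *: v].
Proof.
move=> U vv v0 uE Zf; have [l0 u0] := phased_neq0 U; case: U => ll uu _ _.
have [c ff] := peirce0_rank1 vv v0 Zf.
have E : (c - 2 * l) *: v = (2 * l) *: f - 2 *: (v ** f).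
  have := uu; rewrite uE !bxE vv (bxC H f v) ff => E.
  by apply: (lin_comb (a := 1) E) => z; rewrite !ipEl; ring.
have Zvf := peirce0_bx f vv.
have Z : peirce0 v ((2 * l) *: f - 2 *: (v ** f)) by apply: peirce0B; apply: peirce0Z.
have cl : c = 2 * l.
  apply/eqP; rewrite -subr_eq0; move: (peirce0_ip vv v0 Z); rewrite -E ipZl => /eqP.
  by rewrite mulf_eq0 (negPf (ip_neq0 v0)) orbF.
have vf : v ** f = l *: f.
  apply: (@scale_inj 2); first by rewrite pnatr_eq0.
  move: E; rewrite cl subrr scale0r => E.
  by apply: (lin_comb (a := 1) E) => z; rewrite !ipEl; ring.
have f0 : f != 0.
  apply: contra_neq u0 => f0; move: uu; rewrite uE f0 addr0 vv => /esym/eqP.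
  rewrite scaler_eq0 mulf_eq0 pnatr_eq0 (negPf l0) => /eqP //.
split=> //; last by rewrite ff cl.
move: Zf; rewrite /peirce0 vf bxZr vf scalerA mulrC ll scale1r => /esym/eqP.
by rewrite -subr_eq0 -{2}[f]scale1r -scalerBl => /eqP/(scale_eq0 f0)/eqP; rewrite subr_eq0 => /eqP.
Qed.

(** Otherwise [u ** u], and hence [u], would lie on the line of [v], to which the Peirce-0 space is
    orthogonal. *)
Lemma phased_not_peirce0 l u v : phased_unitary l u -> v ** v = 0 -> v != 0 -> ~ peirce0 v u.
Proof.
move=> U vv v0 Zu; have [l0 u0] := phased_neq0 U; case: U => ll uu _ _.
have [c uuc] := peirce0_rank1 vv v0 Zu.
have Ev : u = (c / (2 * l)) *: v.
  apply: (@scale_inj (2 * l)); first by rewrite mulf_neq0 ?pnatr_eq0.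
  by rewrite -uu uuc scalerA mulrC divfK // mulf_neq0 ?pnatr_eq0.
move: (peirce0_ip vv v0 Zu) (ip_neq0 u0); rewrite {3}Ev ipZr => ->.
by rewrite mulr0 eqxx.
Qed.

(** * A rank one element that splits two unitary elements *)

Lemma pencil_root l m e u : phased_unitary l e -> phased_unitary m u ->
  exists2 a, a != 0 & ip (u - a *: e) ((u - a *: e) ** (u - a *: e)) = 0.
Proof.
move=> Ue Uu; have De := phased_det Ue; have Du := phased_det Uu.
have [l0 e0] := phased_neq0 Ue; have [m0 u0] := phased_neq0 Uu.
pose p := ip e (u ** u); pose q := ip u (e ** e).
have D a : ip (u - a *: e) ((u - a *: e) ** (u - a *: e)) =
    6 * m^* - 3 * p * a + 3 * q * a ^+ 2 - 6 * l^* * a ^+ 3.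
  have p1 : ip u (e ** u) = p by rewrite ip_bx.
  have q1 : ip e (u ** e) = q by rewrite ip_bx.
  rewrite !bxE !ipE De Du (bxC H u e) p1 (bxC H e u) q1 -/p -/q !conjCK.
  ring.
(* The cubic solved for its leading power. Its constant coefficient is nonzero, so the root is
   nonzero. *)
pose c i := [:: m^* / l^*; - p / (2 * l^*); q / (2 * l^*)]`_i.
have [x xE] := @solve_monicpoly C 3 c isT.
have lc0 : l^* != 0 by rewrite conjC_eq0.
exists x.
  apply: contra_eq_neq xE => ->; rewrite expr0n /= !big_ord_recl big_ord0 /c /=.
  by rewrite !expr0n /= !mulr0 !addr0 mulr1 eq_sym mulf_neq0 ?invr_eq0 // conjC_eq0.
rewrite D xE !big_ord_recl big_ord0 /c /= /bump /=.
by field.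
Qed.

(** Among the products of [u] and [e], only [u ** e] need not be a combination of [u] and [e]. It
    enters [w ** w] with the nonzero coefficient -2 a^*, so it can be eliminated in favour of
    [w ** w]. *)
Lemma phased_pencil l m e u a : phased_unitary l e -> phased_unitary m u -> a != 0 ->
  let w := u - a *: e in
  (w ** w = 0 -> exists b c, b != 0 /\ w ** e = b *: w + c *: e) /\
  (exists b c d, d != 0 /\ w ** w ** e = b *: w + c *: e + d *: (w ** w)).
Proof.
move=> Ue Uu a0 w; have [l0 e0] := phased_neq0 Ue; have [m0 u0] := phased_neq0 Uu.
case: Ue Uu => ll ee _ Ge [mm uu _ _].
have two0 : 2 != 0 :> C by rewrite pnatr_eq0.
have ac0 : a^* != 0 by rewrite conjC_eq0.
have ww : w ** w = (2 * m) *: u - (2 * a^*) *: (u ** e) + (2 * a^* ^+ 2 * l) *: e.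
  rewrite /w !bxE uu ee (bxC H e u).
  by apply: ip_ext => z; rewrite !ipEl; ring.
have we : w ** e = u ** e - (2 * a^* * l) *: e.
  by rewrite /w !bxE ee; apply: ip_ext => z; rewrite !ipEl; ring.
split=> [w0|].
  exists (m / a^*), (m / a^* * a - a^* * l); split; first by rewrite mulf_neq0 ?invr_eq0.
  move: ww; rewrite w0 we => E; apply: (lin_comb (a := (2 * a^*)^-1) E) => z.
  by rewrite /w !ipEl; field; exact: ac0.
pose b := 2 * m * m^* / a^* - 2 * a.
exists b, (a * b + 2 * m^* * l * a^* - 2 * a * ip u e + 4 * a ^+ 2 * (l * l^*)), (- m^* / a^*).
split; first by rewrite mulf_neq0 ?invr_eq0 ?oppr_eq0 ?conjC_eq0.
have -> : w ** w ** e =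
    (2 * m^*) *: (u ** e) - (2 * a) *: (u + ip u e *: e) + (4 * a ^+ 2 * l^* * l) *: e.
  rewrite ww !bxE ee -(Ge u) (bxC H e u).
  by apply: ip_ext => z; rewrite !ipEl !rmorphM /= ?rmorphXn /= ?conjCK; ring.
rewrite ww; apply: ip_ext => z; rewrite /w /b !ipEl; field; exact: ac0.
Qed.
(** The remaining clause is [bx_cube] divided by 6 l^*, once [u ** u] is replaced by its multiple of
    [u]. *)
Lemma phased_intro l u : l * l^* = 1 -> u ** u = (2 * l) *: u -> ip u u = 3 ->
  phased_unitary l u.
Proof.
move=> ll uu n; split=> // x; have := bx_cube u x; rewrite uu bxZl ipZr n.
have k0 : 6 * l^* != 0.
  rewrite mulf_neq0 ?pnatr_eq0 // conjC_eq0; apply/eqP => l0.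
  by move: ll; rewrite l0 mul0r => /esym/eqP; rewrite oner_eq0.
rewrite ipZr !rmorphM /= !rmorph_nat => E; apply: (@scale_inj (6 * l^*)) => //.
by rewrite (bxC H _ u); apply: (lin_comb (a := 1) E) => z; rewrite !ipEl; ring.
Qed.

Lemma phased_split_neq l m e u : phased_unitary l e -> phased_unitary m u ->
  (forall a, u <> a *: e) ->
  exists v a, [/\ v ** v = 0, v != 0, peirce0 v (e - v) & peirce0 v (u - a *: v)].
Proof.
move=> Ue Uu ue; have [a a0 Da] := pencil_root Ue Uu.
have [P1 P2] := phased_pencil Ue Uu a0.
have w0 : u - a *: e != 0 by rewrite subr_eq0; apply/eqP/ue.
have [r [c [d [r0 rr Ze Zw]]]] := pencil_rank1 w0 Da P1 P2.
have c0 : c != 0.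
  by apply/eqP => c0; move: Ze; rewrite c0 scale0r subr0; apply: phased_not_peirce0 Ue rr r0.
(* Rescaling [r] gives [e] the coefficient 1; along [r] itself, [u] has the coefficient
   [d + a * c]. *)
exists (c *: r), ((d + a * c) / c); split.
- by rewrite !bxE rr !scaler0.
- by rewrite scaler_eq0 negb_or c0.
- exact: peirce0_scale.
apply: peirce0_scale => //; rewrite scalerA divfK //.
rewrite (_ : u - _ = (u - a *: e - d *: r) + a *: (e - c *: r)); last first.
  by apply: ip_ext => z; rewrite !ipEl; ring.
by apply: peirce0D => //; apply: peirce0Z.
Qed.

Lemma frame_sum l v1 v2 v3 a1 a2 a3 : frame l v1 v2 v3 ->
  let u := a1 *: v1 + a2 *: v2 + a3 *: v3 in
  [/\ u ** u = (2 * l * (a2 * a3)^*) *: v1 + (2 * l * (a3 * a1)^*) *: v2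
               + (2 * l * (a1 * a2)^*) *: v3,
      ip u u = a1 * a1^* + a2 * a2^* + a3 * a3^*,
      ip u v1 = a1, ip u v2 = a2 & ip u v3 = a3].
Proof.
case=> [[h1 h2 h3]] [n1 n2 n3] [o1 o2 o3] [p1 p2 p3] u.
have [q1 q2 q3] := And3 (ip_sym0 o1) (ip_sym0 o2) (ip_sym0 o3).
rewrite {}/u; split.
- rewrite !bxE h1 h2 h3 (bxC H v2 v1) (bxC H v3 v2) (bxC H v1 v3) p1 p2 p3.
  by apply: ip_ext => z; rewrite !ipE; ring.
- by rewrite !ipE n1 n2 n3 o1 o2 o3 q1 q2 q3; ring.
- by rewrite !ipE n1 q1 o3 !(mulr0, mulr1, add0r, addr0).
- by rewrite !ipE n2 o1 q2 !(mulr0, mulr1, add0r, addr0).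
- by rewrite !ipE n3 q3 o2 !(mulr0, mulr1, add0r, addr0).
Qed.

(** The sum of a frame has phase [l]; unimodular coefficients multiply it by the conjugate of their
    product. *)
Lemma frame_phased l v1 v2 v3 a1 a2 a3 m : frame l v1 v2 v3 ->
  a1 * a1^* = 1 -> a2 * a2^* = 1 -> a3 * a3^* = 1 -> m * m^* = 1 ->
  l * (a1 * a2 * a3)^* = m -> phased_unitary m (a1 *: v1 + a2 *: v2 + a3 *: v3).
Proof.
move=> F m1 m2 m3 mm lm; have [uu n _ _ _] := frame_sum a1 a2 a3 F.
apply: phased_intro => //; last by rewrite n m1 m2 m3; ring.
rewrite uu !scalerDr !scalerA -lm; congr (_ *: _ + _ *: _ + _ *: _); rewrite !rmorphM /=.
- by rewrite -[LHS]mulr1 -m1; ring.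
- by rewrite -[LHS]mulr1 -m2; ring.
- by rewrite -[LHS]mulr1 -m3; ring.
Qed.

Lemma phased_split l m e u : phased_unitary l e -> phased_unitary m u ->
  exists v a, [/\ v ** v = 0, v != 0, peirce0 v (e - v) & peirce0 v (u - a *: v)].
Proof.
move=> Ue Uu.
have [[a ue] | nue] := pselect (exists a, u = a *: e); last first.
  by apply: phased_split_neq Ue Uu _ => a ue; apply: nue; exists a.
suff [v [vv v0 Ze]] : exists v, [/\ v ** v = 0, v != 0 & peirce0 v (e - v)].
  by exists v, a; split=> //; rewrite ue -scalerBr; apply: peirce0Z.
(* It remains to split [e] alone. [F 1] and [F (-1)] are unitary and cannot both be multiples of
   [e], so one of them can play the part of [u] in [phased_split_neq]. *)
pose F b := 1 *: E1 + b *: E2 + b *: E3.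
have FU b : b * b^* = 1 -> b * b = 1 -> phased_unitary 1 (F b).
  move=> b1 b2; apply: (frame_phased HE) => //; rewrite ?rmorph1 ?mulr1 ?mul1r //.
  by rewrite b2 rmorph1.
have FP b : b * b^* = 1 -> b * b = 1 -> (forall a, F b <> a *: e) ->
    exists v, [/\ v ** v = 0, v != 0 & peirce0 v (e - v)].
  move=> b1 b2 /(phased_split_neq Ue (FU b b1 b2)) [v [c [vv v0 Ze _]]].
  by exists v.
have [[b Fb] | n1] := pselect (exists b, F 1 = b *: e); last first.
  by apply: (FP 1); rewrite ?rmorph1 ?mulr1 // => b Fb; apply: n1; exists b.
have [[c Fc] | n1] := pselect (exists c, F (-1) = c *: e); last first.
  by apply: (FP (-1)); rewrite ?rmorphN1 ?mulrNN ?mulr1 // => c Fc; apply: n1; exists c.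
have [_ _ i1 i2 _] := frame_sum 1 1 1 HE.
have [_ _ j1 j2 _] := frame_sum 1 (-1) (-1) HE.
rewrite -/(F 1) Fb in i1 i2; rewrite -/(F (-1)) Fc in j1 j2.
move: i1 i2 j1 j2; rewrite !ipZl => i1 i2 j1 j2.
have E2' : ip e E1 * b * (c * ip e E2) = ip e E1 * c * (b * ip e E2) by ring.
move: E2'; rewrite j2 i2 !(mulrC (ip e E1)) i1 j1 mulrN1 mulr1 => /eqP.
by rewrite -subr_eq0 -opprD oppr_eq0 (_ : 1 + 1 = 2%:R) ?pnatr_eq0.
Qed.

(** * The spin factor complementary to a rank one tripotent *)

Lemma peirce0_bxbx v x y : v ** v = 0 -> ip v v = 1 -> peirce0 v x -> peirce0 v y ->
  x ** y = ip (v ** x) y *: v.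
Proof.
rewrite /peirce0 => vv n; rewrite n !scale1r => Zx Zy.
by rewrite -{1}Zx -{1}Zy rank1_bxbx // ip_bx (bxC H _ v) Zy.
Qed.

(* If [v ** V] were a line, the symmetric form [ip v (x ** y)] would have rank at most one,
   so it would vanish as soon as [x ** x = 0]. *)
Lemma peirce0_not_line v f : v != 0 -> exists y, forall c, v ** y <> c *: f.
Proof.
move=> v0; have [// | N] := pselect (exists y, forall c, v ** y <> c *: f).
have L y : exists c, v ** y = c *: f.
  have [// | N'] := pselect (exists c, v ** y = c *: f).
  by exfalso; apply: N; exists y => c E; apply: N'; exists c.
exfalso; move/eqP: v0; apply.
suff P y : y ** y = 0 -> v ** y = 0.
  by case: HE => [[h1 h2 h3]] _ _ _; apply: HE0; apply: P.
move=> yy; have [c Ec] := L y.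
have [c0 | c0] := eqVneq c 0; first by rewrite Ec c0 scale0r.
apply: ip_ext => z; rewrite ip0l -ipC; apply/eqP; rewrite conjC_eq0; apply/eqP.
have [d Ed] := L z.
have yf : ip y f = 0.
  apply/eqP; have := rank1_ipr yy v; rewrite bxC Ec ipZr => /eqP.
  by rewrite mulf_eq0 conjC_eq0 (negPf c0).
(* By symmetry of the cubic form this value is [ip y (v ** z)], a multiple of [ip y f]. *)
by rewrite ip_bx bxC -ip_bx bxC -ip_bxC bxC -ip_bx bxC Ed ipZr yf mulr0.
Qed.
Lemma unimodular_sqrt c : c * c^* = 1 -> exists2 w, w ^+ 2 = c & w * w^* = 1.
Proof.
move=> cc; exists (sqrtC c); first by rewrite sqrtCK.
apply/eqP; rewrite -normCK sqrp_eq1 //; apply/eqP.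
apply: (@pexpIrn _ 2) => //; rewrite ?nnegrE //.
apply: (@pexpIrn _ 2) => //; rewrite ?nnegrE ?exprn_ge0 //.
by rewrite -normrX sqrtCK !expr1n normCK cc.
Qed.

(** As [v ** _] is conjugate-linear, passing from [g] to [c *: g] changes the eigenvalue [k] into k
    c^* / c. The phase of [c] is a square root of - k l^*, which makes this - l; its modulus adjusts
    the norm. *)
Lemma peirce0_rotate l k v g : l * l^* = 1 -> k * k^* = 1 -> g != 0 -> v ** g = k *: g ->
  exists2 c, c != 0 & v ** (c *: g) = - l *: (c *: g) /\ ip (c *: g) (c *: g) = 2.
Proof.
move=> ll kk g0 vg.
have kl : - (k * l^*) * (- (k * l^*))^* = 1.
  rewrite rmorphN rmorphM /= conjCK; transitivity (k * k^* * (l * l^*)); first by ring.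
  by rewrite kk ll mulr1.
have [w ww w1] := unimodular_sqrt kl.
have n0 := ip_neq0 g0.
pose p := sqrtC (2 / ip g g).
have p2 : p ^+ 2 = 2 / ip g g by rewrite sqrtCK.
have pR : p^* = p.
  by apply: geC0_conj; rewrite sqrtC_ge0 divr_ge0 ?ip_ge0 // ler0n.
have p0 : p != 0.
  by rewrite -sqrf_eq0 p2 mulf_neq0 ?invr_eq0 // pnatr_eq0.
have w0 : w != 0.
  by apply/eqP => E; move: w1; rewrite E mul0r => /esym/eqP; rewrite oner_eq0.
exists (p * w); first by rewrite mulf_neq0.
split; last first.
  rewrite ipZl ipZr rmorphM /= pR.
  transitivity (p ^+ 2 * (w * w^*) * ip g g); first by ring.
  by rewrite w1 p2 mulr1 divfK.
rewrite bxZr vg !scalerA rmorphM /= pR; congr (_ *: _).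
apply: (mulfI w0); transitivity (p * k * (w * w^*)); first by ring.
transitivity (- p * l * w ^+ 2); last by ring.
rewrite w1 ww; transitivity (p * k * (l * l^*)); last by ring.
by rewrite ll.
Qed.

(* In the Peirce-0 space of [v], conjugation by [v ** _] is a real structure for which [f] is
   real; a vector [g] orthogonal to [f] and purely imaginary splits [f] as [(f + g) / 2] and
   [(f - g) / 2]. *)
Lemma frame_of_imaginary l v f g : l * l^* = 1 -> v ** v = 0 -> ip v v = 1 ->
  peirce0 v f -> peirce0 v g -> v ** f = l *: f -> v ** g = - l *: g ->
  ip f f = 2 -> ip g g = 2 -> ip f g = 0 ->
  frame l v (2^-1 *: (f + g)) (2^-1 *: (f - g)).
Proof.
move=> ll vv n Zf Zg vf vg ff gg fg.
have v0 : v != 0 by apply/eqP => E; move: n; rewrite E ip0l => /esym/eqP; rewrite oner_eq0.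
have gf := ip_sym0 fg.
have [fv gv] := (peirce0_ip vv v0 Zf, peirce0_ip vv v0 Zg).
have [vf0 vg0] := (ip_sym0 fv, ip_sym0 gv).
have bff : f ** f = (2 * l) *: v by rewrite (peirce0_bxbx vv n Zf Zf) vf ipZl ff mulrC.
have bgg : g ** g = - (2 * l) *: v.
  by rewrite (peirce0_bxbx vv n Zg Zg) vg ipZl gg mulrC mulrN.
have bfg : f ** g = 0 by rewrite (peirce0_bxbx vv n Zf Zg) vf ipZl fg mulr0 scale0r.
have c2 : (2^-1)^* = 2^-1 :> C by rewrite fmorphV rmorph_nat.
have two0 : 2 != 0 :> C by rewrite pnatr_eq0.
split; split; rewrite ?bxE ?vv ?bff ?bgg ?(bxC H g f) ?bfg ?(bxC H _ v) ?vf ?vg ?ipE ?c2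
  ?n ?ff ?gg ?fg ?gf ?fv ?gv ?vf0 ?vg0 //.
all: try by field.
all: apply: ip_ext => z; rewrite !ipE ?c2; by field.
Qed.
(** The components [f] and [u'] of [e] and [u] in the Peirce-0 space are eigenvectors of the
    conjugate-linear map [v ** _]. So is the part of [u'] orthogonal to [f]; if nonzero, it can be
    rotated into the imaginary vector for [frame_of_imaginary]. *)
Lemma frame_split l m e u v a : phased_unitary l e -> phased_unitary m u ->
  v ** v = 0 -> v != 0 -> peirce0 v (e - v) -> peirce0 v (u - a *: v) ->
  exists v2 v3 b c, frame l v v2 v3 /\ e = v + v2 + v3 /\ u = a *: v + b *: v2 + c *: v3.
Proof.
move=> Ue Uu vv v0 Zf Zu.
have two0 : 2 != 0 :> C by rewrite pnatr_eq0.
have [f eE] : exists f, e = v + f by exists (e - v); rewrite addrC subrK.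
have [u' uE] : exists u', u = a *: v + u' by exists (u - a *: v); rewrite addrC subrK.
have sub_l x y : x + y - x = y by rewrite addrC addKr.
rewrite eE sub_l in Zf; rewrite uE sub_l in Zu.
have [n vf ff] := phased_peirce Ue vv v0 eE Zf.
have a0 : a != 0.
  by apply/eqP => a0; move: Uu; rewrite uE a0 scale0r add0r => /phased_not_peirce0/(_ vv v0).
have avv : (a *: v) ** (a *: v) = 0 by rewrite !bxE vv !scaler0.
have av0 : a *: v != 0 by rewrite scaler_eq0 negb_or a0.
have [aa vu _] := phased_peirce Uu avv av0 uE (peirce0_scale a0 Zu).
have {}aa : a * a^* = 1 by move: aa; rewrite ipZl ipZr n mulr1.
have [ll _ ne _] := Ue; have [mm _ _ _] := Uu.
have fv := peirce0_ip vv v0 Zf; have vf0 := ip_sym0 fv.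
have nf : ip f f = 2.
  by move: ne; rewrite eE !ipE n fv vf0 addr0 add0r => E; apply: (addrI 1); rewrite E; ring.
have f0 : f != 0 by apply/eqP => E; move: nf; rewrite E ip0l => /esym/eqP; rewrite pnatr_eq0.
have {}vu : v ** u' = (a * m) *: u'.
  have <- : a *: (m *: u') = (a * m) *: u' by rewrite scalerA.
  by rewrite -vu bxZl scalerA aa scale1r.
pose b := ip u' f / 2; have [g0 g0E] : exists g0, g0 = u' - b *: f by eexists.
have Zg0 : peirce0 v g0 by rewrite g0E; apply: peirce0B => //; apply: peirce0Z.
have gf0 : ip g0 f = 0 by rewrite g0E !ipE nf divfK // subrr.
have vgf : ip (v ** g0) f = 0.
  by rewrite -ipC ip_bx ip_bx (bxC H f v) vf ipZr gf0 mulr0 rmorph0.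
(* The left side is a multiple of [f] and the right side is orthogonal to [f], so both vanish. *)
have E : (a * m * b - b^* * l) *: f = v ** g0 - (a * m) *: g0.
  have E := vu; rewrite (_ : u' = b *: f + g0) in E; last by rewrite g0E addrC subrK.
  move: E; rewrite bxDr bxZr vf => E.
  by apply: (lin_comb (a := -1) E) => z; rewrite !ipEl; ring.
have vg0 : v ** g0 = (a * m) *: g0.
  have := congr1 (ip ^~ f) E; rewrite /= !ipEl nf vgf gf0 mulr0 oppr0 addr0 => /eqP.
  rewrite mulf_eq0 (negPf two0) orbF => /eqP E0.
  by apply/eqP; rewrite -subr_eq0 -E E0 scale0r.
have {E vgf} [g [k [d [[gn Zg gf] [kk vg ug]]]]] : exists g k d,
    [/\ g != 0, peirce0 v g & ip g f = 0] /\
    [/\ k * k^* = 1, v ** g = k *: g & u' = b *: f + d *: g].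
  have uE' : u' = b *: f + g0 by rewrite g0E addrC subrK.
  have [g00 | g00] := eqVneq g0 0; last first.
    exists g0, (a * m), 1; split; split=> //; last by rewrite scale1r.
    by rewrite rmorphM /=; transitivity (a * a^* * (m * m^*)); [ring | rewrite aa mm mulr1].
  have {}uE' : forall g, u' = b *: f + 0 *: g by move=> g; rewrite scale0r uE' g00.
  (* Now [u'] is a multiple of [f], and any eigenvector orthogonal to [f] will do. Project some
     [v ** y] to [h] orthogonal to [f] and take its imaginary part [h']; if that is zero, [h] is an
     eigenvector for [l]. *)
  have [y yf] := peirce0_not_line f v0.
  have [h hE] : exists h, h = v ** y - (ip (v ** y) f / 2) *: f by eexists.
  have hf : ip h f = 0 by rewrite hE !ipE nf divfK // subrr.
  have h0 : h != 0 by rewrite hE subr_eq0; apply/eqP/yf.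
  have Zh : peirce0 v h.
    by rewrite hE; apply: peirce0B; [apply: peirce0_bx | apply: peirce0Z].
  have vh : v ** (v ** h) = h by rewrite Zh n scale1r.
  have [h' h'E] : exists h', h' = h - l^* *: (v ** h) by eexists.
  have [h'0 | h'0] := eqVneq h' 0.
    exists h, l, 0; split; split=> //.
    by rewrite h'E in h'0; apply: (lin_comb (a := - l) h'0) => z;
      rewrite !ipEl -[X in X - _]mul1r -ll; ring.
  exists h', (- l), 0; split; split=> //.
  - by rewrite h'E; apply: peirce0B => //; apply: peirce0Z; apply: peirce0_bx.
  - rewrite h'E !ipE hf -ipC ip_bx ip_bx (bxC H f v) vf ipZr hf.
    by rewrite mulr0 rmorph0 mulr0 subr0.
  - by rewrite rmorphN mulrNN.
  - rewrite h'E !bxE vh conjCK; apply: ip_ext => z; rewrite !ipEl.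
    by transitivity (l * l^* * ip (v ** h) z - l * ip h z); [rewrite ll|]; ring.
have [c c0 [vcg ncg]] := peirce0_rotate ll kk gn vg.
have fcg : ip f (c *: g) = 0 by apply: ip_sym0; rewrite ipZl gf mulr0.
have F := frame_of_imaginary ll vv n Zf (peirce0Z c Zg) vf vcg nf ncg fcg.
(* [f] is the sum and [c *: g] the difference of these two vectors, whence the coefficients. *)
exists (2^-1 *: (f + c *: g)), (2^-1 *: (f - c *: g)), (b + d / c), (b - d / c).
split=> //; split.
  by rewrite eE; apply: ip_ext => z; rewrite !ipEl; field.
by rewrite uE ug; apply: ip_ext => z; rewrite !ipEl; field.
Qed.

(** Coordinates of [u ** u] = 2 m u show that each squared modulus is the product of the other two;
    being nonnegative with sum 3, all three are 1. *)
Lemma frame_unimodular l m v1 v2 v3 a b c : frame l v1 v2 v3 ->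
  l * l^* = 1 -> phased_unitary m (a *: v1 + b *: v2 + c *: v3) ->
  [/\ a * a^* = 1, b * b^* = 1 & c * c^* = 1].
Proof.
move=> F ll [mm uu n _].
have [uu' n' _ _ _] := frame_sum a b c F.
have two0 : 2 != 0 :> C by rewrite pnatr_eq0.
have [_ _ i1 i2 i3] := frame_sum (2 * l * (b * c)^*) (2 * l * (c * a)^*) (2 * l * (a * b)^*) F.
have [_ _ j1 j2 j3] := frame_sum a b c F.
rewrite uu' in uu.
have e1 : l * (b * c)^* = m * a.
  by apply: (mulfI two0); rewrite !mulrA -i1 uu ipZl j1.
have e2 : l * (c * a)^* = m * b.
  by apply: (mulfI two0); rewrite !mulrA -i2 uu ipZl j2.
have e3 : l * (a * b)^* = m * c.
  by apply: (mulfI two0); rewrite !mulrA -i3 uu ipZl j3.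
pose A := a * a^*; pose B := b * b^*; pose D := c * c^*.
have sq (x y z : C) : l * (x * y)^* = m * z -> (x * x^*) * (y * y^*) = z * z^*.
  move=> E; have := congr1 (fun t : C => t * t^*) E; rewrite !rmorphM /= !conjCK => E'.
  transitivity (l * l^* * (x * x^*) * (y * y^*)); first by rewrite ll mul1r.
  transitivity (m * m^* * (z * z^*)); last by rewrite mm mul1r.
  by transitivity (l * (x^* * y^*) * (l^* * (x * y))); [ring | rewrite E'; ring].
have := sq _ _ _ e1; have := sq _ _ _ e2; have := sq _ _ _ e3.
rewrite -/A -/B -/D => q3 q2 q1.
have sumE : A + B + D = 3 by rewrite /A /B /D -n' n.
have A0 : 0 <= A by rewrite /A mul_conjC_ge0.
have B0 : 0 <= B by rewrite /B mul_conjC_ge0.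
have D0 : 0 <= D by rewrite /D mul_conjC_ge0.
have eqv (x y z : C) : 0 <= x -> 0 <= y -> x * z = y -> z * y = x -> x = y.
  move=> x0 y0 xy yx; apply/eqP; rewrite -(eqrXn2 (n := 2)) //.
  by rewrite !expr2 -{2}yx mulrA xy.
have AB : A = B by apply: (eqv A B D) => //; rewrite mulrC.
have BD : B = D by apply: (eqv B D A) => //; rewrite mulrC.
have B1 : B = 1.
  apply: (mulfI (_ : 3 != 0)); first by rewrite pnatr_eq0.
  by rewrite mulr1 -[RHS]sumE AB -BD; ring.
by split; rewrite -?/A -?/B -?/D ?AB -?BD.
Qed.

(** * Tripotents, orthogonality and minimality *)

Lemma tripotent_sq v : tripl v v v = v -> v ** v ** v = (2 * (ip v v - 1)) *: v.
Proof.
by move/tripl_eq => E; apply: (lin_comb (a := -1) E) => z; rewrite !ipEl; ring.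
Qed.

Lemma tripotent_orthogonal v w : tripl v v v = v -> tripl v v w = 0 ->
  [/\ ip w v = 0, v ** w ** v = ip v v *: w
    & (2 * (ip v v - 1)) *: (v ** w) = (ip v (v ** w))^* *: v].
Proof.
move=> /tripotent_sq T /tripl_eq; rewrite scaler0 => E.
have sR : (ip v v)^* = ip v v by rewrite ipC.
have cR : (2 * (ip v v - 1))^* = 2 * (ip v v - 1).
  by rewrite rmorphM rmorphB /= sR rmorph1 rmorph_nat.
have two0 : 2 != 0 :> C by rewrite pnatr_eq0.
have wv : ip w v = 0.
  have := congr1 (ip ^~ v) E; rewrite /= !ipEl.
  have -> : ip (v ** w ** v) v = 2 * (ip v v - 1) * ip w v.
    by rewrite -ipC ip_bx ipC ip_bx ip_bx T ipZr cR.
  by move=> E'; apply: (mulfI two0); rewrite mulr0 -[RHS]E'; ring.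
have vwv : v ** w ** v = ip v v *: w.
  by apply: (lin_comb (a := -1) E) => z; rewrite !ipEl wv; ring.
split=> //; have := quartic_dual v v v w.
rewrite (bxC H v (v ** v)) T (bxC H v (v ** w)) vwv !bxZr cR sR (ip_sym0 wv) (bxC H w v) => E'.
by apply: (lin_comb (a := 1) E') => z; rewrite !ipEl; ring.
Qed.

(* The Peirce-0 space of a tripotent [v] of rank two is the line through [v ** v]. *)
Lemma tripotent_rank1 v w w' : v != 0 -> w != 0 -> w' != 0 ->
  tripl v v v = v -> tripl w w w = w -> tripl v v w = 0 -> tripl v v w' = 0 ->
  tripl w w w' = 0 -> v ** v = 0 /\ ip v v = 1.
Proof.
move=> v0 w0 w'0 Tv Tw vw vw' ww'.
have s0 := ip_neq0 v0.
have two0 : 2 != 0 :> C by rewrite pnatr_eq0.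
have [s1 | s1] := eqVneq (ip v v) 1.
  split=> //; have := tripotent_sq Tv; rewrite s1 subrr mulr0 scale0r => E.
  by apply: (ip_eq0 (h := H)); rewrite -ip_bx E ip0r.
(* With [ip v v] different from 1, [v ** x] is a multiple of [v], so [x] is one of [v ** v]. Then
   [w] and [w'] lie on one line, although they are nonzero and orthogonal. *)
have line x : tripl v v x = 0 -> exists a, x = a *: (v ** v).
  move=> vx; have [_ vxv E] := tripotent_orthogonal Tv vx.
  set c := (_)^* in E.
  exists ((ip v v)^-1 * (c / (2 * (ip v v - 1)))^*).
  apply: (scale_inj s0); rewrite -vxv scalerA mulrA divff // mul1r -bxZl; congr (_ ** _).
  have k0 : 2 * (ip v v - 1) != 0 by rewrite mulf_neq0 // subr_eq0.
  by apply: (scale_inj k0); rewrite E scalerA mulrC divfK.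
have [a wE] := line w vw; have [b w'E] := line w' vw'.
have [w'w _ _] := tripotent_orthogonal Tw ww'.
exfalso; move: w'w; rewrite wE w'E ipZl ipZr => /eqP.
rewrite !mulf_eq0 conjC_eq0 => /or3P [] /eqP E.
- by move: w'0; rewrite w'E E scale0r eqxx.
- by move: w0; rewrite wE E scale0r eqxx.
- by move: w0; rewrite wE (ip_eq0 E) scaler0 eqxx.
Qed.

Lemma frame_tripl l v1 v2 v3 : l * l^* = 1 -> frame l v1 v2 v3 ->
  [/\ tripl v1 v1 v1 = v1, tripl v1 v1 v2 = 0, tripl v1 v1 v3 = 0,
      tripl (v2 + v3) (v2 + v3) (v2 + v3) = v2 + v3 & tripl (v2 + v3) (v2 + v3) v1 = 0].
Proof.
move=> ll [] [h1 h2 h3] [n1 n2 n3] [o1 o2 o3] [p1 p2 p3].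
have [q1 q2 q3] := And3 (ip_sym0 o1) (ip_sym0 o2) (ip_sym0 o3).
have lc : l^* * l = 1 by rewrite mulrC.
have P := (bxC H v2 v1, bxC H v3 v2, bxC H v1 v3).
split; apply/tripl_eq; rewrite ?bxE ?P ?p1 ?p2 ?p3 ?h1 ?h2 ?h3 ?bxE ?P ?p1 ?p2 ?p3 ?h1 ?h2 ?h3
 ?ipE ?n1 ?n2 ?n3 ?o1 ?o2 ?o3 ?q1 ?q2 ?q3; apply: ip_ext => z; rewrite ?scalerA ?lc !ipEl; ring.
Qed.

(** The component [y] of [x] orthogonal to [v] satisfies [v ** y ** v = - y]. Pairing with [y]
    equates the square norm of [v ** y] with minus that of [y], so [y = 0]. *)
Lemma rank1_minimal v x : v ** v = 0 -> ip v v = 1 -> tripl v v x = x <-> exists a, x = a *: v.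
Proof.
move=> vv n; split=> [/tripl_eq E | [a ->]]; last first.
  by apply/tripl_eq; rewrite !bxE vv !bxE ipZl n; apply: ip_ext => z; rewrite !ipEl; ring.
exists (ip x v); pose y := x - ip x v *: v.
have yv : ip y v = 0 by rewrite !ipE n mulr1 subrr.
have E' : - (v ** y ** v) = y.
  have -> : v ** y = v ** x by rewrite /y !bxE vv scaler0 subr0.
  by apply: (lin_comb (a := 1) E) => z; rewrite !ipEl n; ring.
have : ip y y = 0.
  apply/eqP; rewrite eq_le ip_ge0 andbT -oppr_ge0 -{2}E' ipNr opprK ip_adj.
  exact: ip_ge0.
by move/ip_eq0/eqP; rewrite subr_eq0 => /eqP.
Qed.

Lemma exists_frame l m e u : phased_unitary l e -> phased_unitary m u ->
  exists v1 v2 v3 a b c, [/\ frame l v1 v2 v3, e = v1 + v2 + v3,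
    u = a *: v1 + b *: v2 + c *: v3 & [/\ a * a^* = 1, b * b^* = 1 & c * c^* = 1]].
Proof.
move=> Ue Uu; have [v [a [vv v0 Ze Zu]]] := phased_split Ue Uu.
have [v2 [v3 [b [c [F [eE uE]]]]]] := frame_split Ue Uu vv v0 Ze Zu.
exists v, v2, v3, a, b, c; split=> //.
by case: Ue => ll _ _ _; apply: (frame_unimodular F ll (m := m)); rewrite -uE.
Qed.

Lemma det_decomposition l e v1 v2 v3 a b c : phased_unitary l e ->
  v1 != 0 -> v2 != 0 -> v3 != 0 ->
  tripl v1 v1 v1 = v1 -> tripl v2 v2 v2 = v2 -> tripl v3 v3 v3 = v3 ->
  tripl v1 v1 v2 = 0 -> tripl v1 v1 v3 = 0 -> tripl v2 v2 v3 = 0 ->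
  tripl v2 v2 v1 = 0 -> tripl v3 v3 v1 = 0 -> tripl v3 v3 v2 = 0 ->
  (forall v, v = v1 \/ v = v2 \/ v = v3 ->
    tripl (e - v) (e - v) (e - v) = e - v /\ tripl (e - v) (e - v) v = 0) ->
  let u := a *: v1 + b *: v2 + c *: v3 in ip u (u ** u) = a * b * c * ip e (e ** e).
Proof.
move=> [_ _ n _] v10 v20 v30 T1 T2 T3 T12 T13 T23 T21 T31 T32 le u.
have [h1 n1] := tripotent_rank1 v10 v20 v30 T1 T2 T12 T13 T23.
have [h2 n2] := tripotent_rank1 v20 v10 v30 T2 T1 T21 T23 T13.
have [h3 n3] := tripotent_rank1 v30 v10 v20 T3 T1 T31 T32 T12.
have [o1 _ _] := tripotent_orthogonal T1 T12.
have [o2 _ _] := tripotent_orthogonal T2 T23.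
have [o3 _ _] := tripotent_orthogonal T3 T31.
have [q1 q2 q3] := And3 (ip_sym0 o1) (ip_sym0 o2) (ip_sym0 o3).
have ie v : v = v1 \/ v = v2 \/ v = v3 -> ip v v = 1 -> ip v e = 1.
  move=> /le [T O] nv; have [o _ _] := tripotent_orthogonal T O.
  by move: o; rewrite ipDr ipNr nv => /eqP; rewrite subr_eq0 => /eqP.
have i1 : ip v1 e = 1 by apply: ie => //; left.
have i2 : ip v2 e = 1 by apply: ie => //; right; left.
have i3 : ip v3 e = 1 by apply: ie => //; right; right.
have sym1 x y : ip x y = 1 -> ip y x = 1 by move=> E; rewrite -ipC E rmorph1.
(* The difference has square norm 3 - 6 + 3 = 0. *)
have eE : e = v1 + v2 + v3.
  apply/eqP; rewrite -subr_eq0; apply/eqP/(ip_eq0 (h := H)).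
  rewrite !ipE n n1 n2 n3 o1 o2 o3 q1 q2 q3 i1 i2 i3 !(sym1 _ e) //; ring.
have D (x y z : C) : ip (x *: v1 + y *: v2 + z *: v3)
    ((x *: v1 + y *: v2 + z *: v3) ** (x *: v1 + y *: v2 + z *: v3))
    = 6 * (x * y * z) * ip v1 (v2 ** v3).
  rewrite !bxE h1 h2 h3 (bxC H v2 v1) (bxC H v3 v2) (bxC H v1 v3) !ipE !conjCK.
  have Z v t : v ** v = 0 -> ip v (t ** v) = 0 by move=> vv; rewrite bxC rank1_ipr.
  rewrite !(rank1_ipr h1) !(rank1_ipr h2) !(rank1_ipr h3) !(Z _ _ h1) !(Z _ _ h2) !(Z _ _ h3).
  rewrite (ip_bx H v3 v1 v2) -(ip_bx H v1 v2 v3) ?ip0r; ring.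
rewrite /u D (_ : e = 1 *: v1 + 1 *: v2 + 1 *: v3) ?D; last by rewrite !scale1r.
by ring.
Qed.
End WithFrame.
End HermitianCubic.

(* [odiam] is the linear conjugation, [obar] the conjugation of coefficients. *)
Record composition (C : numClosedFieldType) (O : lmodType C) := Composition {
  omul : O -> O -> O;
  odiam : O -> O;
  obar : O -> O;
  odot : O -> O -> C;
  odotC : forall a b, odot a b = odot b a;
  odotDl : forall a b c, odot (a + b) c = odot a c + odot b c;
  odotZl : forall k a b, odot (k *: a) b = k * odot a b;
  odot_ext : forall a b, (forall c, odot a c = odot b c) -> a = b;
  omulDl : forall a b c, omul (a + b) c = omul a c + omul b c;
  omulZl : forall k a b, omul (k *: a) b = k *: omul a b;
  odiamK : forall a, odiam (odiam a) = a;
  odiamD : forall a b, odiam (a + b) = odiam a + odiam b;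
  odiamZ : forall k a, odiam (k *: a) = k *: odiam a;
  odiamM : forall a b, odiam (omul a b) = omul (odiam b) (odiam a);
  odot_diam : forall a b, odot (odiam a) b = odot a (odiam b);
  odotMl : forall a b c, odot (omul a b) c = odot b (omul (odiam a) c);
  odotMM : forall a b, odot (omul a b) (omul a b) = odot a a * odot b b;
  obarD : forall a b, obar (a + b) = obar a + obar b;
  obarZ : forall k a, obar (k *: a) = k^* *: obar a;
  obarK : forall a, obar (obar a) = a;
  obarM : forall a b, obar (omul a b) = omul (obar a) (obar b);
  obar_diam : forall a, obar (odiam a) = odiam (obar a);
  odot_bar : forall a b, odot (obar a) (obar b) = (odot a b)^*;
  oone : O;
  oone_mul : forall a, omul oone a = a;
  odiam_one : odiam oone = oone;
  onorm_polar : forall a b,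
    omul a (odiam b) + omul b (odiam a) = (2 * odot a b) *: oone;
  odot_ge0 : forall a, 0 <= odot a (obar a);
  odot_eq0 : forall a, odot a (obar a) = 0 -> a = 0 }.

(** * The Albert algebra of a composition algebra *)

Section Composition.
Variables (C : numClosedFieldType) (O : lmodType C) (A : composition O).
Local Notation omul := (omul A).
Local Notation odiam := (odiam A).
Local Notation odot := (odot A).
Local Notation obar := (obar A).
Local Notation oone := (oone A).
Implicit Types (a b c d : O) (k : C).

Lemma odotNl a b : odot (- a) b = - odot a b.
Proof. by rewrite -scaleN1r odotZl mulN1r. Qed.
Lemma odot0l b : odot 0 b = 0.
Proof. by rewrite -(scale0r 0) odotZl mul0r. Qed.
Lemma odotDr a b c : odot c (a + b) = odot c a + odot c b.
Proof. by rewrite odotC odotDl !(odotC A _ c). Qed.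
Lemma odotZr k a b : odot b (k *: a) = k * odot b a.
Proof. by rewrite odotC odotZl odotC. Qed.
Lemma odotNr a b : odot b (- a) = - odot b a.
Proof. by rewrite odotC odotNl odotC. Qed.
Lemma odot0r b : odot b 0 = 0.
Proof. by rewrite odotC odot0l. Qed.
Lemma odiamN a : odiam (- a) = - odiam a.
Proof. by rewrite -scaleN1r odiamZ scaleN1r. Qed.
Lemma odiam0 : odiam 0 = 0.
Proof. by rewrite -(scale0r 0) odiamZ !scale0r. Qed.
Lemma omulNl a b : omul (- a) b = - omul a b.
Proof. by rewrite -scaleN1r omulZl scaleN1r. Qed.
Lemma omul0l b : omul 0 b = 0.
Proof. by rewrite -(scale0r 0) omulZl !scale0r. Qed.
Lemma omulDr a b c : omul c (a + b) = omul c a + omul c b.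
Proof. by apply: (can_inj (odiamK A)); rewrite odiamM !odiamD omulDl !odiamM. Qed.
Lemma omulZr k a b : omul b (k *: a) = k *: omul b a.
Proof. by apply: (can_inj (odiamK A)); rewrite odiamM !odiamZ omulZl !odiamM. Qed.
Lemma omulNr a b : omul b (- a) = - omul b a.
Proof. by rewrite -scaleN1r omulZr scaleN1r. Qed.
Lemma omul0r b : omul b 0 = 0.
Proof. by rewrite -(scale0r 0) omulZr !scale0r. Qed.
Lemma obarN a : obar (- a) = - obar a.
Proof. by rewrite -scaleN1r obarZ rmorphN1 scaleN1r. Qed.
Lemma obar0 : obar 0 = 0.
Proof. by rewrite -(scale0r 0) obarZ rmorph0 !scale0r. Qed.

Definition odotE := (odotDl, odotZl, odotNl, odot0l, odotDr, odotZr, odotNr, odot0r).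
Definition omulE := (omulDl, omulZl, omulNl, omul0l, omulDr, omulZr, omulNr, omul0r).
Definition odiamE := (odiamD, odiamZ, odiamN, odiam0).
Definition obarE := (obarD, obarZ, obarN, obar0).

(** * Identities of composition algebras *)

Lemma odotMr a b c : odot (omul a b) c = odot a (omul c (odiam b)).
Proof.
rewrite -{1}(odiamK A (omul a b)) odot_diam odiamM odotMl odiamK.
by rewrite -[c in RHS](odiamK A) -odiamM -odot_diam.
Qed.

Lemma odotMMr a b d : odot (omul a b) (omul a d) = odot a a * odot b d.
Proof.
have := odotMM A a (b + d); rewrite !omulE !odotE !odotMM.
rewrite (odotC A (omul a d)) (odotC A d b) => E.
apply: (@mulfI _ 2); first by rewrite pnatr_eq0.
set x := odot (omul a b) _ in E *.
transitivity (odot a a * odot b b + x + (x + odot a a * odot d d)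
  - odot a a * odot b b - odot a a * odot d d); first by ring.
by rewrite E; ring.
Qed.

Lemma odotMM_polar a b c d :
  odot (omul a b) (omul c d) + odot (omul a d) (omul c b) = 2 * odot a c * odot b d.
Proof.
have := odotMMr (a + c) b d; rewrite !omulE !odotE !odotMMr.
rewrite (odotC A (omul c b)) (odotC A c a) => E.
set x := odot (omul a b) _ in E *; set y := odot (omul a d) _ in E *.
transitivity (odot a a * odot b d + x + (y + odot c c * odot b d)
  - odot a a * odot b d - odot c c * odot b d); first by ring.
by rewrite E; ring.
Qed.

Lemma omulKdiam a b : omul a (omul (odiam a) b) = odot a a *: b.
Proof.
by apply: (odot_ext (c0 := A)) => z; rewrite odotMl odotMMr odotZl odot_diam odiamK.
Qed.
Lemma omul_diamK a b : omul (odiam a) (omul a b) = odot a a *: b.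
Proof. by rewrite -{2}[a](odiamK A) omulKdiam odot_diam odiamK. Qed.
Lemma omulMdiam a b : omul (omul b a) (odiam a) = odot a a *: b.
Proof.
by apply: (can_inj (odiamK A)); rewrite !odiamM odiamK omulKdiam odiamZ.
Qed.
Lemma odot_cycle a b c : odot a (odiam (omul b c)) = odot b (odiam (omul c a)).
Proof. by rewrite !odiamM -(odotMr a b) odotMl. Qed.

(** The Moufang identity (ab)(ca) = a(bc)a, with the right side expanded through the norm form.
    Pairing with [z] reduces it to [odotMM_polar]. *)
Lemma middle_moufang a b c : omul (omul a b) (omul c a) =
  (2 * odot a (odiam (omul b c))) *: a - odot a a *: odiam (omul b c).
Proof.
apply: (odot_ext (c0 := A)) => z; rewrite odotMr odiamM !odotE.
have := odotMM_polar a b z (omul (odiam a) (odiam c)).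
have -> : odot b (omul (odiam a) (odiam c)) = odot a (odiam (omul b c)).
  by rewrite -odotMl odiamM odotMr.
rewrite omulKdiam odotZl.
have -> : odot (odiam c) (omul z b) = odot (odiam (omul b c)) z.
  by rewrite odiamM odotMr odiamK.
move=> E; rewrite -[LHS](addrK (odot a a * odot (odiam (omul b c)) z)) E; ring.
Qed.

(** * Freudenthal product and trace form of the Albert algebra *)

Definition albert : lmodType C := (C^o * C^o * C^o * (O * O * O))%type.
(* [hrm p q r a b c] encodes the matrix with diagonal p, q, r and entries a, b, c in positions
   (2,3), (3,1), (1,2). *)
Definition hrm (p q r : C) (a b c : O) : albert := ((p, q, r), (a, b, c)).

Lemma albert_ind (P : albert -> Prop) :
  (forall p q r a b c, P (hrm p q r a b c)) -> forall x, P x.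
Proof. by move=> h x; case: x => [[[p q] r] [[a b] c]]; apply: h. Qed.

(** The polarised adjoint, scaled so that [cross x x] is twice the adjoint of [x]. *)
Definition cross (x y : albert) : albert :=
  let: ((x1, x2, x3), (a1, a2, a3)) := x in
  let: ((y1, y2, y3), (b1, b2, b3)) := y in
  hrm ((x2 : C) * y3 + (y2 : C) * x3 - 2 * odot a1 b1)
      ((x3 : C) * y1 + (y3 : C) * x1 - 2 * odot a2 b2)
      ((x1 : C) * y2 + (y1 : C) * x2 - 2 * odot a3 b3)
      (odiam (omul a2 b3) + odiam (omul b2 a3) - (x1 : C) *: b1 - (y1 : C) *: a1)
      (odiam (omul a3 b1) + odiam (omul b3 a1) - (x2 : C) *: b2 - (y2 : C) *: a2)
      (odiam (omul a1 b2) + odiam (omul b1 a2) - (x3 : C) *: b3 - (y3 : C) *: a3).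

(** The trace of the Jordan product, bilinear over the complex numbers. *)
Definition trf (x y : albert) : C :=
  let: ((x1, x2, x3), (a1, a2, a3)) := x in
  let: ((y1, y2, y3), (b1, b2, b3)) := y in
  (x1 : C) * y1 + (x2 : C) * y2 + (x3 : C) * y3
  + 2 * (odot a1 b1 + odot a2 b2 + odot a3 b3).

Definition abar (x : albert) : albert :=
  let: ((x1, x2, x3), (a1, a2, a3)) := x in
  hrm (x1 : C)^* (x2 : C)^* (x3 : C)^* (obar a1) (obar a2) (obar a3).

Lemma crossE x1 x2 x3 a1 a2 a3 y1 y2 y3 b1 b2 b3 :
  cross (hrm x1 x2 x3 a1 a2 a3) (hrm y1 y2 y3 b1 b2 b3) =
  hrm (x2 * y3 + y2 * x3 - 2 * odot a1 b1)
      (x3 * y1 + y3 * x1 - 2 * odot a2 b2)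
      (x1 * y2 + y1 * x2 - 2 * odot a3 b3)
      (odiam (omul a2 b3) + odiam (omul b2 a3) - x1 *: b1 - y1 *: a1)
      (odiam (omul a3 b1) + odiam (omul b3 a1) - x2 *: b2 - y2 *: a2)
      (odiam (omul a1 b2) + odiam (omul b1 a2) - x3 *: b3 - y3 *: a3).
Proof. by []. Qed.
Lemma trfE x1 x2 x3 a1 a2 a3 y1 y2 y3 b1 b2 b3 :
  trf (hrm x1 x2 x3 a1 a2 a3) (hrm y1 y2 y3 b1 b2 b3) =
  x1 * y1 + x2 * y2 + x3 * y3 + 2 * (odot a1 b1 + odot a2 b2 + odot a3 b3).
Proof. by []. Qed.
Lemma abarE x1 x2 x3 a1 a2 a3 :
  abar (hrm x1 x2 x3 a1 a2 a3) = hrm x1^* x2^* x3^* (obar a1) (obar a2) (obar a3).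
Proof. by []. Qed.
Lemma hrmD x1 x2 x3 a1 a2 a3 y1 y2 y3 b1 b2 b3 :
  hrm x1 x2 x3 a1 a2 a3 + hrm y1 y2 y3 b1 b2 b3 =
  hrm (x1 + y1) (x2 + y2) (x3 + y3) (a1 + b1) (a2 + b2) (a3 + b3).
Proof. by []. Qed.
Lemma hrmZ k x1 x2 x3 a1 a2 a3 : k *: hrm x1 x2 x3 a1 a2 a3 =
  hrm (k * x1) (k * x2) (k * x3) (k *: a1) (k *: a2) (k *: a3).
Proof. by []. Qed.
Lemma hrmN x1 x2 x3 a1 a2 a3 :
  - hrm x1 x2 x3 a1 a2 a3 = hrm (- x1) (- x2) (- x3) (- a1) (- a2) (- a3).
Proof. by []. Qed.
Lemma hrm0 : 0 = hrm 0 0 0 0 0 0. Proof. by []. Qed.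

Lemma crossC x y : cross x y = cross y x.
Proof.
elim/albert_ind: x => x1 x2 x3 a1 a2 a3; elim/albert_ind: y => y1 y2 y3 b1 b2 b3.
rewrite !crossE (odotC A b1) (odotC A b2) (odotC A b3).
by congr hrm; try ring; rewrite (addrC (odiam _)) addrAC.
Qed.
Lemma crossDl x y z : cross (x + y) z = cross x z + cross y z.
Proof.
elim/albert_ind: x => x1 x2 x3 a1 a2 a3; elim/albert_ind: y => y1 y2 y3 b1 b2 b3.
elim/albert_ind: z => z1 z2 z3 c1 c2 c3.
rewrite !(hrmD, crossE); congr hrm; rewrite ?odotE; try ring;
  by apply: (odot_ext (c0 := A)) => d; rewrite !omulE !odiamE !odotE; ring.
Qed.
Lemma crossZl k x z : cross (k *: x) z = k *: cross x z.
Proof.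
elim/albert_ind: x => x1 x2 x3 a1 a2 a3; elim/albert_ind: z => z1 z2 z3 c1 c2 c3.
rewrite !(hrmZ, crossE); congr hrm; rewrite ?odotE; try ring;
  by apply: (odot_ext (c0 := A)) => d; rewrite !omulE !odiamE !odotE; ring.
Qed.

Lemma trfC x y : trf x y = trf y x.
Proof.
elim/albert_ind: x => x1 x2 x3 a1 a2 a3; elim/albert_ind: y => y1 y2 y3 b1 b2 b3.
rewrite !trfE (odotC A b1) (odotC A b2) (odotC A b3); ring.
Qed.
Lemma trfDl x y z : trf (x + y) z = trf x z + trf y z.
Proof.
elim/albert_ind: x => x1 x2 x3 a1 a2 a3; elim/albert_ind: y => y1 y2 y3 b1 b2 b3.
elim/albert_ind: z => z1 z2 z3 c1 c2 c3; rewrite !(hrmD, trfE) !odotE; ring.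
Qed.
Lemma trfZl k x z : trf (k *: x) z = k * trf x z.
Proof.
elim/albert_ind: x => x1 x2 x3 a1 a2 a3; elim/albert_ind: z => z1 z2 z3 c1 c2 c3.
rewrite !(hrmZ, trfE) !odotE; ring.
Qed.

Lemma trf_cross x y z : trf x (cross y z) = trf y (cross z x).
Proof.
elim/albert_ind: x => x1 x2 x3 a1 a2 a3; elim/albert_ind: y => y1 y2 y3 b1 b2 b3.
elim/albert_ind: z => z1 z2 z3 c1 c2 c3; rewrite !(crossE, trfE) !odotE.
rewrite (odot_cycle a1 b2 c3) (odot_cycle a1 c2 b3) (odot_cycle a2 b3 c1) (odot_cycle a2 c3 b1).
rewrite (odot_cycle a3 b1 c2) (odot_cycle a3 c1 b2).
rewrite (odot_cycle c2 b3 a1) (odot_cycle c3 b1 a2) (odot_cycle c1 b2 a3).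
rewrite (odotC A c1 a1) (odotC A c2 a2) (odotC A c3 a3).
rewrite (odotC A b1 a1) (odotC A b2 a2) (odotC A b3 a3).
ring.
Qed.

Lemma quartic_cross x : 3 *: cross (cross x x) (cross x x) = (4 * trf x (cross x x)) *: x.
Proof.
elim/albert_ind: x => p q r a b c.
have E1 := odot_cycle c a b.
have E2 := odot_cycle a b c.
pose y := hrm (q * r - odot a a) (r * p - odot b b) (p * q - odot c c)
  (odiam (omul b c) - p *: a) (odiam (omul c a) - q *: b) (odiam (omul a b) - r *: c).
(* [y] is the adjoint. Its own adjoint has off-diagonal products of the shape (ab)(ca), which
   [middle_moufang] evaluates. *)
have -> : cross (hrm p q r a b c) (hrm p q r a b c) = 2 *: y.
  rewrite crossE hrmZ; congr hrm; try ring;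
  by apply: (odot_ext (c0 := A)) => d; rewrite !odotE; ring.
rewrite crossZl crossC crossZl /y crossE !hrmZ trfE.
have dMM d1 d2 : odiam (omul (odiam d1) (odiam d2)) = omul d2 d1.
  by rewrite odiamM !odiamK.
have dl d1 d2 : odiam (omul (odiam (omul d1 d2)) d1) = odot d1 d1 *: d2.
  by rewrite odiamM odiamK omul_diamK.
have dr d1 d2 : odiam (omul d1 (odiam (omul d2 d1))) = odot d1 d1 *: d2.
  by rewrite odiamM odiamK omulMdiam.
have dd d1 d2 d3 d4 : odot (odiam (omul d1 d2)) (odiam (omul d3 d4)) =
    odot (omul d1 d2) (omul d3 d4).
  by rewrite odot_diam odiamK.
congr hrm; rewrite ?(omulE, odiamE) ?dMM ?dl ?dr ?middle_moufang ?odotE ?dd ?odotMM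
  ?(odotC A (odiam _)) ?E1 -?E2.
- ring.
- ring.
- ring.
- by apply: (odot_ext (c0 := A)) => z; rewrite !odotE ?(odotC A (odiam _)); ring.
- by apply: (odot_ext (c0 := A)) => z; rewrite !odotE ?(odotC A (odiam _)); ring.
- by apply: (odot_ext (c0 := A)) => z; rewrite !odotE ?(odotC A (odiam _)); ring.
Qed.

Lemma abarK x : abar (abar x) = x.
Proof. by elim/albert_ind: x => *; rewrite !abarE !conjCK !obarK. Qed.
Lemma abarD x y : abar (x + y) = abar x + abar y.
Proof.
elim/albert_ind: x => *; elim/albert_ind: y => *.
by rewrite hrmD !abarE hrmD !rmorphD !obarD.
Qed.
Lemma abarZ k x : abar (k *: x) = k^* *: abar x.
Proof.
by elim/albert_ind: x => *; rewrite hrmZ !abarE hrmZ !rmorphM !obarZ.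
Qed.
Lemma abar_cross x y : abar (cross x y) = cross (abar x) (abar y).
Proof.
elim/albert_ind: x => *; elim/albert_ind: y => *.
rewrite !(crossE, abarE) !(rmorphB, rmorphD, rmorphM, rmorph_nat) /=.
by rewrite !obarE !obar_diam !obarM !odot_bar !rmorph1.
Qed.
Lemma trf_bar x y : trf (abar x) (abar y) = (trf x y)^*.
Proof.
elim/albert_ind: x => *; elim/albert_ind: y => *.
by rewrite !abarE !trfE !(rmorph_nat, rmorphD, rmorphM) /= !odot_bar ?rmorph1 ?rmorph_nat.
Qed.

Definition aip x y := trf x (abar y).
Definition abx x y := abar (cross x y).

Lemma aip_ge0 x : 0 <= aip x x.
Proof.
elim/albert_ind: x => p q r a b c; rewrite /aip abarE trfE.
by rewrite !addr_ge0 ?mul_conjC_ge0 ?mulr_ge0 ?addr_ge0 ?odot_ge0 ?ler0n.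
Qed.
Lemma aip_eq0 x : aip x x = 0 -> x = 0.
Proof.
elim/albert_ind: x => p q r a b c; rewrite /aip abarE trfE => /eqP.
rewrite !paddr_eq0 ?addr_ge0 ?mul_conjC_ge0 ?mulr_ge0 ?addr_ge0 ?odot_ge0 ?ler0n //.
rewrite !mulf_eq0 !conjC_eq0 !orbb pnatr_eq0 /= !paddr_eq0 ?addr_ge0 ?odot_ge0 //.
case/andP=> /andP [/andP [/eqP -> /eqP ->] /eqP ->] /andP [/andP [/eqP Ea /eqP Eb] /eqP Ec].
by rewrite (odot_eq0 Ea) (odot_eq0 Eb) (odot_eq0 Ec).
Qed.

Definition albert_hcubic : hcubic albert.
Proof.
apply: (@HCubic C albert aip abx); rewrite /aip /abx.
- by move=> x y z; rewrite trfDl.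
- by move=> a x y; rewrite trfZl.
- by move=> x y; rewrite -trf_bar abarK trfC.
- exact: aip_ge0.
- exact: aip_eq0.
- by move=> x y; rewrite crossC.
- by move=> x y z; rewrite crossDl abarD.
- by move=> a x y; rewrite crossZl abarZ.
- by move=> x y z; rewrite !abarK trf_cross.
- by move=> x; rewrite -abar_cross !abarK quartic_cross.
Defined.

Definition unit1 := hrm 1 0 0 0 0 0.
Definition unit2 := hrm 0 1 0 0 0 0.
Definition unit3 := hrm 0 0 1 0 0 0.

Lemma albert_frame : frame albert_hcubic 1 unit1 unit2 unit3.
Proof.
split; split; rewrite /= /aip /abx ?(crossE, abarE, hrmZ) ?trfE ?(omulE, odiamE, odotE, obarE)
  ?(scale0r, scaler0, mul0r, mulr0, rmorph0, rmorph1, addr0, add0r, subr0, mulr1, oppr0, obar0) //.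
Qed.

Lemma albert_nondegenerate (v : albert) :
  abx v unit1 = 0 -> abx v unit2 = 0 -> abx v unit3 = 0 -> v = 0.
Proof.
have bar0 x : abar x = 0 -> x = 0.
  by move=> E; rewrite -(abarK x) E hrm0 abarE rmorph0 obar0.
move=> /bar0 E1 /bar0 E2 /bar0 E3; move: E1 E2 E3.
elim/albert_ind: v => p q r a b c; rewrite /unit1 /unit2 /unit3 !crossE hrm0.
rewrite ?(omulE, odiamE, odotE, obarE) ?(scale0r, scale1r, scaler0, mul0r, mul1r, mulr0,
  rmorph0, rmorph1, addr0, add0r, subr0, mulr1, sub0r, oppr0) => E1 E2 E3.
have r0 : r = 0 := congr1 (fun x : albert => x.1.1.2) E1.
have q0 : q = 0 := congr1 (fun x : albert => x.1.2) E1.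
have p0 : p = 0 := congr1 (fun x : albert => x.1.2) E2.
have a0 : - a = 0 := congr1 (fun x : albert => x.2.1.1) E1.
have b0 : - b = 0 := congr1 (fun x : albert => x.2.1.2) E2.
have c0 : - c = 0 := congr1 (fun x : albert => x.2.2) E3.
by rewrite r0 q0 p0 -(opprK a) -(opprK b) -(opprK c) a0 b0 c0 !oppr0.
Qed.

(** * Jordan product and triple product *)

Lemma trfNl x y : trf (- x) y = - trf x y.
Proof. by rewrite -scaleN1r trfZl mulN1r. Qed.
Lemma trfDr x y z : trf z (x + y) = trf z x + trf z y.
Proof. by rewrite trfC trfDl !(trfC z). Qed.
Lemma trfZr k x y : trf y (k *: x) = k * trf y x.
Proof. by rewrite trfC trfZl trfC. Qed.
Lemma trfNr x y : trf y (- x) = - trf y x.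
Proof. by rewrite trfC trfNl trfC. Qed.
Definition trfB := (trfDl, trfZl, trfNl, trfDr, trfZr, trfNr).
Lemma trf_ext x y : (forall z, trf x z = trf y z) -> x = y.
Proof. by move=> E; apply: (ip_ext (H := albert_hcubic)) => z; apply: E. Qed.
Lemma crossNl x z : cross (- x) z = - cross x z.
Proof. by rewrite -scaleN1r crossZl scaleN1r. Qed.
Lemma crossDr x y z : cross z (x + y) = cross z x + cross z y.
Proof. by rewrite crossC crossDl !(crossC z). Qed.
Lemma crossZr k x z : cross z (k *: x) = k *: cross z x.
Proof. by rewrite crossC crossZl crossC. Qed.
Lemma crossNr x z : cross z (- x) = - cross z x.
Proof. by rewrite crossC crossNl crossC. Qed.
Definition crossB := (crossDl, crossZl, crossNl, crossDr, crossZr, crossNr).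

Lemma quartic_cross_polar x y z t :
  cross (cross x y) (cross z t) + cross (cross x z) (cross y t) + cross (cross x t) (cross y z) =
  trf x (cross y z) *: t + trf x (cross y t) *: z + trf x (cross z t) *: y + trf y (cross z t) *: x.
Proof.
by have := quartic_polar albert_hcubic x y z t; rewrite /= /aip /abx -!abar_cross !abarK.
Qed.

Definition aone := hrm 1 1 1 0 0 0.

Lemma cross_one x : cross aone x = trf aone x *: aone - x.
Proof.
elim/albert_ind: x => p q r a b c; rewrite /aone crossE trfE hrmZ hrmN hrmD.
rewrite ?(omulE, odiamE, odotE) ?(scale0r, scale1r, scaler0, mulr0, addr0, add0r, subr0, oppr0).
by congr hrm; rewrite ?(sub0r, scaleN1r) //; ring.
Qed.
(** Polarisation of x^2 = x# + T(x) x - S(x) 1, where T is the trace and S(x) the trace of x#. *)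
Definition ajordan x y : albert := 2^-1 *: (cross x y + trf aone x *: y + trf aone y *: x
  - (trf aone x * trf aone y - trf x y) *: aone).

Lemma trf_one_cross x y : trf aone (cross x y) = trf aone x * trf aone y - trf x y.
Proof. by rewrite trf_cross (crossC y) cross_one !trfB (trfC x aone) mulrC. Qed.

Lemma trf_one_one : trf aone aone = 3.
Proof. by rewrite /aone trfE !odotE; ring. Qed.

(** Up to terms with traces, the two sides differ by a quarter of the symmetric sum of
    [cross (cross x y) z]. The polarised quartic identity with the unit in its last slot reduces
    that sum to traces and single products. *)
Lemma ajordan_triple x y z :
  ajordan (ajordan x y) z + ajordan (ajordan z y) x - ajordan (ajordan x z) y
  = 2^-1 *: (trf x y *: z + trf z y *: x - cross (cross x z) y).
Proof.
have two0 : 2 != 0 :> C by rewrite pnatr_eq0.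
have lin (a p q r s : C) : r = s -> p - q = a * (r - s) -> p = q.
  by move=> -> E; apply/eqP; rewrite -subr_eq0 E subrr mulr0.
have := quartic_cross_polar x y z aone.
rewrite !(crossC _ aone) !cross_one !crossB !(crossC _ aone) !cross_one => E.
apply: trf_ext => t.
have {E} := congr1 (trf ^~ t) E; rewrite /ajordan !(crossB, trfB).
rewrite !trf_one_cross ?trfB ?trf_one_one ?(trfC _ aone) ?trf_one_one ?trf_one_cross.
rewrite ?cross_one ?trfB (crossC z y) (crossC y x) (crossC z x) (crossC x (cross y z)).
have N1 : trf (cross x y) z = trf x (cross y z) by rewrite trfC trf_cross.
have N2 : trf (cross y z) x = trf x (cross y z) by rewrite trfC.
have N3 : trf (cross x z) y = trf x (cross y z) by rewrite trfC crossC -trf_cross.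
rewrite ?N1 ?N2 ?N3 ?(trfC z y) ?(trfC z x) ?(trfC y x).

move/(@lin (- 4^-1)); apply; by field.
Qed.
Lemma ajordan_tripl x y z :
  ajordan (ajordan x (abar y)) z + ajordan (ajordan z (abar y)) x
  - ajordan (ajordan x z) (abar y) = tripl albert_hcubic x y z.
Proof. by rewrite ajordan_triple /tripl /= /aip /abx abar_cross abarK. Qed.

Lemma ajordanE x1 x2 x3 a1 a2 a3 y1 y2 y3 b1 b2 b3 :
  ajordan (hrm x1 x2 x3 a1 a2 a3) (hrm y1 y2 y3 b1 b2 b3) =
  hrm (x1 * y1 + odot a2 b2 + odot a3 b3) (x2 * y2 + odot a3 b3 + odot a1 b1)
      (x3 * y3 + odot a1 b1 + odot a2 b2)
      (2^-1 *: (odiam (omul a2 b3) + odiam (omul b2 a3) + (x2 + x3) *: b1 + (y2 + y3) *: a1))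
      (2^-1 *: (odiam (omul a3 b1) + odiam (omul b3 a1) + (x3 + x1) *: b2 + (y3 + y1) *: a2))
      (2^-1 *: (odiam (omul a1 b2) + odiam (omul b1 a2) + (x1 + x2) *: b3 + (y1 + y2) *: a3)).
Proof.
rewrite /ajordan /aone crossE !trfE !(hrmZ, hrmN, hrmD) !odotE; congr hrm; try by field.
all: by apply: (odot_ext (c0 := A)) => z; rewrite !odotE; field.
Qed.

Definition entry (x : albert) (i j : nat) : O :=
  let: ((x1, x2, x3), (a1, a2, a3)) := x in
  match i, j with
  | 0, 0 => (x1 : C) *: oone | 0, 1 => a3 | 0, _ => odiam a2
  | 1, 0 => odiam a3 | 1, 1 => (x2 : C) *: oone | 1, _ => a1
  | _, 0 => a2 | _, 1 => odiam a1 | _, _ => (x3 : C) *: oone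
  end.

Lemma omul_one a : omul a oone = a.
Proof. by apply: (can_inj (odiamK A)); rewrite odiamM odiam_one oone_mul. Qed.

Lemma entry_jordan x y (i j : 'I_3) : entry (ajordan x y) i j = 2^-1 *:
  (omul (entry x i 0) (entry y 0 j)
   + (omul (entry x i 1) (entry y 1 j) + omul (entry x i 2) (entry y 2 j))
   + (omul (entry y i 0) (entry x 0 j)
      + (omul (entry y i 1) (entry x 1 j) + omul (entry y i 2) (entry x 2 j)))).
Proof.
elim/albert_ind: x => x1 x2 x3 a1 a2 a3; elim/albert_ind: y => y1 y2 y3 b1 b2 b3.
(* On the diagonal the matrix product yields a b^◇ + b a^◇, which [onorm_polar] makes scalar. *)
have Nl a b d : odot (omul a (odiam b)) d = 2 * odot a b * odot oone d - odot (omul b (odiam a)) d.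
  by rewrite -odotZl -onorm_polar odotDl addrK.
have Nr a b d : odot (omul (odiam a) b) d = 2 * odot a b * odot oone d - odot (omul (odiam b) a) d.
  by have := Nl (odiam a) (odiam b) d; rewrite !odiamK odot_diam odiamK.
have Ml k a : omul (k *: oone) a = k *: a by rewrite omulZl oone_mul.
have Mr k a : omul a (k *: oone) = k *: a by rewrite omulZr omul_one.
rewrite ajordanE.
case: i => [[|[|[|//]]] hi]; case: j => [[|[|[|//]]] hj] /=; rewrite ?(Ml, Mr);
  apply: (odot_ext (c0 := A)) => z; rewrite ?odiamE ?odiamM ?odiamK !odotE.
- by rewrite (Nl a3 b3) (Nr a2 b2); field.
- by field.
- by field.
- by field.
- by rewrite (Nl a1 b1) (Nr a3 b3); field.
- by field.
- by field.
- by field.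
- by rewrite (Nl a2 b2) (Nr a1 b1); field.
Qed.
End Composition.

(** * Complex octonions *)

Section Octonions.
Variable R : realType.
Local Notation K := R[i].
Local Notation O := (octonion R).

Definition oct (x0 x1 x2 x3 x4 x5 x6 x7 : K) : O :=
  (((x0, x1), (x2, x3)), ((x4, x5), (x6, x7))).

Lemma octE (x : O) : exists x0 x1 x2 x3 x4 x5 x6 x7, x = oct x0 x1 x2 x3 x4 x5 x6 x7.
Proof.
by case: x => [[[x0 x1] [x2 x3]] [[x4 x5] [x6 x7]]]; exists x0, x1, x2, x3, x4, x5, x6, x7.
Qed.

Lemma oct0 : (0 : O) = oct 0 0 0 0 0 0 0 0. Proof. by []. Qed.
Lemma octD x0 x1 x2 x3 x4 x5 x6 x7 y0 y1 y2 y3 y4 y5 y6 y7 :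
  oct x0 x1 x2 x3 x4 x5 x6 x7 + oct y0 y1 y2 y3 y4 y5 y6 y7
  = oct (x0 + y0) (x1 + y1) (x2 + y2) (x3 + y3) (x4 + y4) (x5 + y5) (x6 + y6) (x7 + y7).
Proof. by []. Qed.
Lemma octN x0 x1 x2 x3 x4 x5 x6 x7 :
  - oct x0 x1 x2 x3 x4 x5 x6 x7 = oct (- x0) (- x1) (- x2) (- x3) (- x4) (- x5) (- x6) (- x7).
Proof. by []. Qed.
Lemma octZ a x0 x1 x2 x3 x4 x5 x6 x7 :
  a *: oct x0 x1 x2 x3 x4 x5 x6 x7
  = oct (a * x0) (a * x1) (a * x2) (a * x3) (a * x4) (a * x5) (a * x6) (a * x7).
Proof. by []. Qed.
Lemma octdiam x0 x1 x2 x3 x4 x5 x6 x7 :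
  cd_diam (oct x0 x1 x2 x3 x4 x5 x6 x7)
  = oct x0 (- x1) (- x2) (- x3) (- x4) (- x5) (- x6) (- x7).
Proof. by []. Qed.
Lemma octbar x0 x1 x2 x3 x4 x5 x6 x7 :
  cd_bar (oct x0 x1 x2 x3 x4 x5 x6 x7)
  = oct x0^* x1^* x2^* x3^* x4^* x5^* x6^* x7^*.
Proof. by []. Qed.
(** The three doublings flattened into coordinates, so that octonion identities become polynomial
    ones. *)
Lemma octM x0 x1 x2 x3 x4 x5 x6 x7 y0 y1 y2 y3 y4 y5 y6 y7 :
  cd_mul (oct x0 x1 x2 x3 x4 x5 x6 x7) (oct y0 y1 y2 y3 y4 y5 y6 y7) = oct
    (x0 * y0 - x1 * y1 - x2 * y2 - x3 * y3 - x4 * y4 - x5 * y5 - x6 * y6 - x7 * y7)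
    (x0 * y1 + x1 * y0 + x3 * y2 - x2 * y3 + x5 * y4 - x4 * y5 + x6 * y7 - x7 * y6)
    (x0 * y2 + x1 * y3 + x2 * y0 - x3 * y1 + x6 * y4 + x7 * y5 - x4 * y6 - x5 * y7)
    (x0 * y3 - x1 * y2 + x2 * y1 + x3 * y0 + x7 * y4 - x6 * y5 + x5 * y6 - x4 * y7)
    (x0 * y4 + x1 * y5 + x2 * y6 + x3 * y7 + x4 * y0 - x5 * y1 - x6 * y2 - x7 * y3)
    (x0 * y5 - x1 * y4 + x2 * y7 - x3 * y6 + x4 * y1 + x5 * y0 + x6 * y3 - x7 * y2)
    (x0 * y6 - x1 * y7 - x2 * y4 + x3 * y5 + x4 * y2 - x5 * y3 + x6 * y0 + x7 * y1)
    (x0 * y7 + x1 * y6 - x2 * y5 - x3 * y4 + x4 * y3 + x5 * y2 - x6 * y1 + x7 * y0).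
Proof.
rewrite /oct /cd_mul /=.
by congr (((_, _), (_, _)), ((_, _), (_, _))); rewrite /=; ring.
Qed.

(** Bilinear, hence with isotropic vectors; positivity belongs to [dot a (cd_bar a)]. *)
Definition dot (x y : O) : K :=
  let: (((x0, x1), (x2, x3)), ((x4, x5), (x6, x7))) := x in
  let: (((y0, y1), (y2, y3)), ((y4, y5), (y6, y7))) := y in
  (x0 : K) * y0 + (x1 : K) * y1 + (x2 : K) * y2 + (x3 : K) * y3
  + (x4 : K) * y4 + (x5 : K) * y5 + (x6 : K) * y6 + (x7 : K) * y7.

Lemma octdot x0 x1 x2 x3 x4 x5 x6 x7 y0 y1 y2 y3 y4 y5 y6 y7 :
  dot (oct x0 x1 x2 x3 x4 x5 x6 x7) (oct y0 y1 y2 y3 y4 y5 y6 y7) =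
  x0 * y0 + x1 * y1 + x2 * y2 + x3 * y3 + x4 * y4 + x5 * y5 + x6 * y6 + x7 * y7.
Proof. by []. Qed.

Lemma octstar x0 x1 x2 x3 x4 x5 x6 x7 :
  cd_star (oct x0 x1 x2 x3 x4 x5 x6 x7)
  = oct x0^* (- x1^*) (- x2^*) (- x3^*) (- x4^*) (- x5^*) (- x6^*) (- x7^*).
Proof. by []. Qed.
Lemma octone : cd_one R 3 = oct 1 0 0 0 0 0 0 0. Proof. by []. Qed.

Definition octC := (octD, octN, octZ, octdiam, octbar, octstar, octM, octdot, oct0, octone).

Local Ltac octs a := have [? [? [? [? [? [? [? [? ->]]]]]]]] := octE a.

Lemma dotC (a b : O) : dot a b = dot b a.
Proof. octs a; octs b; rewrite !octC; ring. Qed.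
Lemma dotDl (a b c : O) : dot (a + b) c = dot a c + dot b c.
Proof. octs a; octs b; octs c; rewrite !octC; ring. Qed.
Lemma dotZl k (a b : O) : dot (k *: a) b = k * dot a b.
Proof. octs a; octs b; rewrite !octC; ring. Qed.
Lemma dot_ext (a b : O) : (forall z, dot a z = dot b z) -> a = b.
Proof.
octs a; octs b => H.
have E := fun x0 x1 x2 x3 x4 x5 x6 x7 => H (oct x0 x1 x2 x3 x4 x5 x6 x7).
congr oct; [move: (E 1 0 0 0 0 0 0 0) | move: (E 0 1 0 0 0 0 0 0)
  | move: (E 0 0 1 0 0 0 0 0) | move: (E 0 0 0 1 0 0 0 0)
  | move: (E 0 0 0 0 1 0 0 0) | move: (E 0 0 0 0 0 1 0 0)
  | move: (E 0 0 0 0 0 0 1 0) | move: (E 0 0 0 0 0 0 0 1)];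
  by rewrite !octC !(mulr0, mulr1, addr0, add0r).
Qed.
Lemma cd_diamK (a : O) : cd_diam (cd_diam a) = a.
Proof. by octs a; rewrite !octC !opprK. Qed.
Lemma cd_diamD (a b : O) : cd_diam (a + b) = cd_diam a + cd_diam b.
Proof. by octs a; octs b; rewrite !octC; congr oct; ring. Qed.
Lemma cd_diamZ k (a : O) : cd_diam (k *: a) = k *: cd_diam a.
Proof. by octs a; rewrite !octC; congr oct; ring. Qed.
Lemma dot_diam (a b : O) : dot (cd_diam a) b = dot a (cd_diam b).
Proof. octs a; octs b; rewrite !octC; ring. Qed.
Lemma cd_diamM (a b : O) : cd_diam (cd_mul a b) = cd_mul (cd_diam b) (cd_diam a).
Proof. octs a; octs b; rewrite !octC; congr oct; ring. Qed.
Lemma cd_mulDl (a b c : O) : cd_mul (a + b) c = cd_mul a c + cd_mul b c.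
Proof. octs a; octs b; octs c; rewrite !octC; congr oct; ring. Qed.
Lemma cd_mulZl k (a b : O) : cd_mul (k *: a) b = k *: cd_mul a b.
Proof. octs a; octs b; rewrite !octC; congr oct; ring. Qed.
Lemma dotMl (a b c : O) : dot (cd_mul a b) c = dot b (cd_mul (cd_diam a) c).
Proof. octs a; octs b; octs c; rewrite !octC; ring. Qed.
Lemma dotMM (a b : O) : dot (cd_mul a b) (cd_mul a b) = dot a a * dot b b.
Proof. octs a; octs b; rewrite !octC; ring. Qed.
Lemma cd_barD (a b : O) : cd_bar (a + b) = cd_bar a + cd_bar b.
Proof. by octs a; octs b; rewrite !octC !rmorphD. Qed.
Lemma cd_barZ k (a : O) : cd_bar (k *: a) = k^* *: cd_bar a.
Proof. by octs a; rewrite !octC !rmorphM. Qed.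
Lemma cd_barK (a : O) : cd_bar (cd_bar a) = a.
Proof. by octs a; rewrite !octC !conjCK. Qed.
Lemma cd_barM (a b : O) : cd_bar (cd_mul a b) = cd_mul (cd_bar a) (cd_bar b).
Proof. by octs a; octs b; rewrite !octC !(rmorphB, rmorphD, rmorphM). Qed.
Lemma cd_bar_diam (a : O) : cd_bar (cd_diam a) = cd_diam (cd_bar a).
Proof. by octs a; rewrite !octC !rmorphN. Qed.
Lemma dot_bar (a b : O) : dot (cd_bar a) (cd_bar b) = (dot a b)^*.
Proof. by octs a; octs b; rewrite !octC !(rmorphD, rmorphM). Qed.
Lemma dot_ge0 (a : O) : 0 <= dot a (cd_bar a).
Proof. by octs a; rewrite !octC !addr_ge0 ?mul_conjC_ge0. Qed.
Lemma dot_eq0 (a : O) : dot a (cd_bar a) = 0 -> a = 0.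
Proof.
octs a; rewrite !octC => /eqP.
rewrite !paddr_eq0 ?addr_ge0 ?mul_conjC_ge0 // !mulf_eq0 !conjC_eq0 !orbb.
by do 7! case/andP; do 8! move=> /eqP ->.
Qed.

Lemma cd_one_mul (a : O) : cd_mul (cd_one R 3) a = a.
Proof. octs a; rewrite !octC; congr oct; ring. Qed.
Lemma cd_diam_one : cd_diam (cd_one R 3) = cd_one R 3.
Proof. by rewrite !octC oppr0. Qed.
Lemma cd_bar_one : cd_bar (cd_one R 3) = cd_one R 3.
Proof. by rewrite !octC rmorph1 rmorph0. Qed.
Lemma cd_starE (a : O) : cd_star a = cd_bar (cd_diam a).
Proof. by octs a; rewrite !octC !rmorphN. Qed.
Lemma cd_norm_polar (a b : O) :
  cd_mul a (cd_diam b) + cd_mul b (cd_diam a) = (2 * dot a b) *: cd_one R 3.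
Proof. octs a; octs b; rewrite !octC; congr oct; ring. Qed.

Definition octonion_composition : composition O :=
  Composition dotC dotDl dotZl dot_ext cd_mulDl cd_mulZl cd_diamK cd_diamD cd_diamZ cd_diamM
    dot_diam dotMl dotMM cd_barD cd_barZ cd_barK cd_barM cd_bar_diam dot_bar
    cd_one_mul cd_diam_one cd_norm_polar dot_ge0 dot_eq0.

(** Diagonal entries of elements of [C6] are fixed by ◇; this makes them scalars, as the coordinates
    [hrm] require. *)
Lemma cd_diam_fix (a : O) : cd_diam a = a -> exists k, a = k *: cd_one R 3.
Proof.
have [x0 [x1 [x2 [x3 [x4 [x5 [x6 [x7 ->]]]]]]]] := octE a; rewrite !octC => E.
have z (x : K) : - x = x -> x = 0.
  by move=> /eqP; rewrite -subr_eq0 -opprD oppr_eq0 -mulr2n mulrn_eq0 => /eqP.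
have z1 := z _ (congr1 (fun t : O => t.1.1.2) E).
have z2 := z _ (congr1 (fun t : O => t.1.2.1) E).
have z3 := z _ (congr1 (fun t : O => t.1.2.2) E).
have z4 := z _ (congr1 (fun t : O => t.2.1.1) E).
have z5 := z _ (congr1 (fun t : O => t.2.1.2) E).
have z6 := z _ (congr1 (fun t : O => t.2.2.1) E).
have z7 := z _ (congr1 (fun t : O => t.2.2.2) E).
by exists x0; rewrite z1 z2 z3 z4 z5 z6 z7 octZ mulr1 mulr0.
Qed.
End Octonions.

(** * Hermitian octonion matrices *)

Section HermitianMatrices.
Variable R : realType.
Local Notation K := R[i].
Local Notation O := (octonion R).
Local Notation M := 'M[octonion R]_3.
Local Notation A := (octonion_composition R).
Local Notation one := (cd_one R 3).
Local Notation V := (albert O).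
Local Notation entry := (entry A).

#[local] Opaque cd_mul cd_diam cd_bar cd_star cd_one dot.

Definition to_mx (x : V) : M := \matrix_(i, j) entry x i j.

Lemma ord3P (P : 'I_3 -> Prop) :
  P ord0 -> P (lift ord0 ord0) -> P (lift ord0 (lift ord0 ord0)) -> forall i, P i.
Proof.
move=> P0 P1 P2 [[|[|[|//]]] h].
- by rewrite (_ : Ordinal h = ord0) //; apply: val_inj.
- by rewrite (_ : Ordinal h = lift ord0 ord0) //; apply: val_inj.
- by rewrite (_ : Ordinal h = lift ord0 (lift ord0 ord0)) //; apply: val_inj.
Qed.

Lemma to_mxE x i j : to_mx x i j = entry x i j.
Proof. exact: mxE. Qed.

Lemma to_mxD x y : to_mx (x + y) = to_mx x + to_mx y.
Proof.
apply/matrixP => i j; rewrite !mxE.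
elim/albert_ind: x => x1 x2 x3 a1 a2 a3; elim/albert_ind: y => y1 y2 y3 b1 b2 b3.
by elim/ord3P: i; elim/ord3P: j; rewrite hrmD /= ?scalerDl ?cd_diamD.
Qed.

Lemma to_mxZ k x : to_mx (k *: x) = omx_scale k (to_mx x).
Proof.
apply/matrixP => i j; rewrite !mxE.
elim/albert_ind: x => x1 x2 x3 a1 a2 a3.
by elim/ord3P: i; elim/ord3P: j; rewrite hrmZ /= ?scalerA ?cd_diamZ.
Qed.

Lemma to_mxN x : to_mx (- x) = - to_mx x.
Proof. by rewrite -scaleN1r to_mxZ; apply/matrixP => i j; rewrite !mxE scaleN1r. Qed.

Lemma to_mx0 : to_mx 0 = 0.
Proof. by rewrite -(subrr 0) to_mxD to_mxN subrr. Qed.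

Lemma to_mx_star x : omx_star (to_mx x) = to_mx (abar A x).
Proof.
apply/matrixP => i j; rewrite !mxE.
elim/albert_ind: x => x1 x2 x3 a1 a2 a3.
by elim/ord3P: i; elim/ord3P: j; rewrite abarE /= cd_starE ?cd_diamK ?cd_diamZ
  ?cd_diam_one ?cd_barZ ?cd_bar_one ?cd_bar_diam.
Qed.

Lemma to_mx_C6 x : C6 (to_mx x).
Proof.
apply/matrixP => i j; rewrite !mxE.
elim/albert_ind: x => x1 x2 x3 a1 a2 a3.
by elim/ord3P: i; elim/ord3P: j; rewrite /= ?cd_diamK ?cd_diamZ ?cd_diam_one.
Qed.

Lemma cd_one_neq0 : one != 0.
Proof. by apply/eqP => /(congr1 (fun t : O => t.1.1.1)) /eqP; rewrite oner_eq0. Qed.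

Lemma to_mx_inj : injective to_mx.
Proof.
move=> x y; elim/albert_ind: x => x1 x2 x3 a1 a2 a3; elim/albert_ind: y => y1 y2 y3 b1 b2 b3.
move/matrixP => E.
have {}E (i j : 'I_3) : entry (hrm x1 x2 x3 a1 a2 a3) i j = entry (hrm y1 y2 y3 b1 b2 b3) i j
  := etrans (esym (to_mxE _ i j)) (etrans (E i j) (to_mxE _ i j)).
pose i1 : 'I_3 := lift ord0 ord0; pose i2 : 'I_3 := lift ord0 (lift ord0 ord0).
have zI (k l : K) : k *: one = l *: one -> k = l.
  move=> /eqP; rewrite -subr_eq0 -scalerBl scaler_eq0 (negPf cd_one_neq0) orbF subr_eq0.
  by move=> /eqP.
have /zI-> : x1 *: one = y1 *: one := E ord0 ord0.
have /zI-> : x2 *: one = y2 *: one := E i1 i1.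
have /zI-> : x3 *: one = y3 *: one := E i2 i2.
have -> : a1 = b1 := E i1 i2.
have -> : a2 = b2 := E i2 ord0.
by have -> : a3 = b3 := E ord0 i1.
Qed.

Lemma C6_to_mx (y : M) : C6 y -> exists x, y = to_mx x.
Proof.
move=> /matrixP E; have {}E i j : cd_diam (y j i) = y i j by have := E i j; rewrite mxE.
have [p Ep] := cd_diam_fix (E ord0 ord0).
have [q Eq] := cd_diam_fix (E (lift ord0 ord0) (lift ord0 ord0)).
have [r Er] := cd_diam_fix (E (lift ord0 (lift ord0 ord0)) (lift ord0 (lift ord0 ord0))).
exists (hrm p q r (y (lift ord0 ord0) (lift ord0 (lift ord0 ord0)))
  (y (lift ord0 (lift ord0 ord0)) ord0) (y ord0 (lift ord0 ord0))).
apply/matrixP => i j; rewrite to_mxE.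
elim/ord3P: i; elim/ord3P: j.
- exact: Ep.
- exact: erefl.
- exact: esym (E _ _).
- exact: esym (E _ _).
- exact: Eq.
- exact: erefl.
- exact: erefl.
- exact: esym (E _ _).
- exact: Er.
Qed.

Lemma to_mx_one : to_mx (aone O) = omx_one R.
Proof.
apply/matrixP => i j; rewrite !mxE.
by elim/ord3P: i; elim/ord3P: j; rewrite /= ?scale1r // -(scale0r (0 : O)) cd_diamZ !scale0r.
Qed.

Lemma to_mx_jordan x y : jordan (to_mx x) (to_mx y) = to_mx (ajordan A x y).
Proof.
apply/matrixP => i j; rewrite to_mxE (entry_jordan A x y i j).
rewrite /jordan /omx_scale /omx_mul !mxE !big_ord_recl !big_ord0 !addr0.
by rewrite !to_mxE.
Qed.

Lemma to_mx_triple x y z :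
  triple (to_mx x) (to_mx y) (to_mx z) = to_mx (tripl (albert_hcubic A) x y z).
Proof.
rewrite /triple to_mx_star !to_mx_jordan -to_mxN -!to_mxD; congr to_mx.
exact: ajordan_tripl.
Qed.

(** * Transfer to [C6] and computation of [dt_rel] *)

Local Notation H := (albert_hcubic A).
Local Notation det x := (ip H x (bx H x x)).
Implicit Types (x y z : V).

Lemma unitary_to_mx x : unitary (to_mx x) -> forall y, tripl H x x y = y.
Proof. by case=> _ h y; apply: to_mx_inj; rewrite -to_mx_triple; apply: h; apply: to_mx_C6. Qed.

Lemma tripotent_to_mx x : tripotent (to_mx x) <-> tripl H x x x = x.
Proof.
split; first by case=> _ h; apply: to_mx_inj; rewrite -to_mx_triple.
by move=> h; split; [apply: to_mx_C6 | rewrite to_mx_triple h].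
Qed.

Lemma orthogonal_to_mx x y : Defs.orthogonal (to_mx x) (to_mx y) <-> tripl H x x y = 0.
Proof.
rewrite /Defs.orthogonal to_mx_triple; split=> [h | ->]; last exact: to_mx0.
by apply: to_mx_inj; rewrite h to_mx0.
Qed.

Lemma tripotent_le_to_mx x y : tripotent_le (to_mx x) (to_mx y) <->
  tripl H (y - x) (y - x) (y - x) = y - x /\ tripl H (y - x) (y - x) x = 0.
Proof.
rewrite /tripotent_le -to_mxN -to_mxD.
by split=> [[/tripotent_to_mx ? /orthogonal_to_mx ?] | [? ?]]; split=> //;
  [exact/tripotent_to_mx | exact/orthogonal_to_mx].
Qed.

Lemma minimal_tripotent_neq0 x : minimal_tripotent (to_mx x) -> x != 0.
Proof.
case=> _ _ n0; apply/eqP => x0; apply: n0; rewrite x0 to_mx0.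
have s0 (a : K) : omx_scale a (0 : M) = 0 by apply/matrixP => i j; rewrite !mxE scaler0.
apply/predeqP => y; split=> [[a _ <-] | ->]; first by rewrite s0.
by exists 0 => //; rewrite s0.
Qed.

Lemma rank1_minimal_tripotent x : bx H x x = 0 -> ip H x x = 1 -> minimal_tripotent (to_mx x).
Proof.
move=> xx n; have x0 : x != 0.
  by apply/eqP => x0; move: n; rewrite x0 ip0l => /esym/eqP; rewrite oner_eq0.
split.
- by apply/tripotent_to_mx/rank1_minimal => //; exists 1; rewrite scale1r.
- apply/predeqP => y; split=> [[/C6_to_mx [z ->]] | [a _ <-]].
    rewrite to_mx_triple => /to_mx_inj /(rank1_minimal _ xx n) [a ->].
    by exists a => //; rewrite to_mxZ.
  rewrite /= -to_mxZ; split; first exact: to_mx_C6.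
  by rewrite to_mx_triple; congr to_mx; apply/rank1_minimal => //; exists a.
- move/predeqP/(_ (to_mx x)) => [h _].
  have : [set 0] (to_mx x).
    by apply: h; exists 1 => //; rewrite -to_mxZ scale1r.
  by rewrite /= -to_mx0 => /to_mx_inj/eqP; apply/negP.
Qed.

Lemma det_neq0 l x : phased_unitary H l x -> det x != 0.
Proof.
move=> U; rewrite (phased_det U) mulf_neq0 ?pnatr_eq0 // conjC_eq0.
by case: (phased_neq0 U).
Qed.

Lemma sum3 (T : nmodType) (f : 'I_3 -> T) :
  \sum_j f j = f ord0 + f (lift ord0 ord0) + f (lift ord0 (lift ord0 ord0)).
Proof. by rewrite !big_ord_recl big_ord0 addr0 addrA. Qed.

(** Every decomposition has the same product of coefficients, so the choice made by [xget] does not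
    matter. *)
Lemma dt_decomposition_det l e u alpha v : phased_unitary H l e ->
  dt_decomposition (to_mx e) (to_mx u) alpha v -> \prod_j alpha j * det e = det u.
Proof.
move=> Ue [_ vmin vorth vle usum].
have vE j : exists w, v j = to_mx w by case: (vmin j) => -[/C6_to_mx].
pose i1 : 'I_3 := lift ord0 ord0; pose i2 : 'I_3 := lift ord0 (lift ord0 ord0).
have [w0 E0] := vE ord0; have [w1 E1] := vE i1; have [w2 E2] := vE i2.
have uE : u = alpha ord0 *: w0 + alpha i1 *: w1 + alpha i2 *: w2.
  by apply: to_mx_inj; rewrite usum sum3 E0 E1 E2 !to_mxD !to_mxZ.
rewrite uE (det_decomposition (l := l) (e := e)) //.
- by rewrite !big_ord_recl big_ord0 mulr1 !mulrA.
- by apply: minimal_tripotent_neq0; rewrite -E0.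
- by apply: minimal_tripotent_neq0; rewrite -E1.
- by apply: minimal_tripotent_neq0; rewrite -E2.
- by apply/tripotent_to_mx; rewrite -E0; case: (vmin ord0).
- by apply/tripotent_to_mx; rewrite -E1; case: (vmin i1).
- by apply/tripotent_to_mx; rewrite -E2; case: (vmin i2).
- by apply/orthogonal_to_mx; rewrite -E0 -E1; apply: vorth.
- by apply/orthogonal_to_mx; rewrite -E0 -E2; apply: vorth.
- by apply/orthogonal_to_mx; rewrite -E1 -E2; apply: vorth.
- by apply/orthogonal_to_mx; rewrite -E1 -E0; apply: vorth.
- by apply/orthogonal_to_mx; rewrite -E2 -E0; apply: vorth.
- by apply/orthogonal_to_mx; rewrite -E2 -E1; apply: vorth.
- by move=> w [-> | [-> | ->]]; apply/tripotent_le_to_mx; rewrite -?E0 -?E1 -?E2; apply: vle.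
Qed.

Lemma frame_rotate l v1 v2 v3 : frame H l v1 v2 v3 -> frame H l v2 v3 v1.
Proof. by case=> [[? ? ?]] [? ? ?] [? ? ?] [? ? ?]; split; split. Qed.

Lemma frame_dt_decomposition l v1 v2 v3 a b c : l * l^* = 1 -> frame H l v1 v2 v3 ->
  a * a^* = 1 -> b * b^* = 1 -> c * c^* = 1 ->
  exists alpha v,
    dt_decomposition (to_mx (v1 + v2 + v3)) (to_mx (a *: v1 + b *: v2 + c *: v3)) alpha v.
Proof.
move=> ll F aa bb cc.
have norm1 (k : K) : k * k^* = 1 -> `|k| = 1.
  by move=> kk; apply/eqP; rewrite -sqrp_eq1 // normCK kk.
have [T1 T12 T13 Tf1 Tf1'] := frame_tripl ll F.
have [T2 T23 T21 Tf2 Tf2'] := frame_tripl ll (frame_rotate F).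
have [T3 T31 T32 Tf3 Tf3'] := frame_tripl ll (frame_rotate (frame_rotate F)).
have [[h1 h2 h3] [n1 n2 n3] _ _] := F.
have f1 : v1 + v2 + v3 - v1 = v2 + v3 by rewrite -(addrA v1 v2 v3) [v1 + _]addrC addrK.
have f2 : v1 + v2 + v3 - v2 = v3 + v1 by rewrite addrAC addrK [v1 + _]addrC.
have f3 : v1 + v2 + v3 - v3 = v1 + v2 by rewrite addrK.
pose w (i : 'I_3) := match val i with 0 => v1 | 1 => v2 | _ => v3 end.
exists (fun i : 'I_3 => match val i with 0 => a | 1 => b | _ => c end), (fun i => to_mx (w i)).
split.
- by elim/ord3P; apply: norm1.
- by elim/ord3P; apply: rank1_minimal_tripotent.
- move=> i j; elim/ord3P: i; elim/ord3P: j => ij; apply/orthogonal_to_mx.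
  + by exfalso; move: ij; rewrite eqxx.
  + exact: T12.
  + exact: T13.
  + exact: T21.
  + by exfalso; move: ij; rewrite eqxx.
  + exact: T23.
  + exact: T31.
  + exact: T32.
  + by exfalso; move: ij; rewrite eqxx.
- elim/ord3P; apply/tripotent_le_to_mx; rewrite /w /= ?f1 ?f2 ?f3.
  + exact: conj Tf1 Tf1'.
  + exact: conj Tf2 Tf2'.
  + exact: conj Tf3 Tf3'.
- by rewrite sum3 /= -!to_mxZ -!to_mxD.
Qed.

Let HF := albert_frame A.
Let HN : forall v, bx H v (unit1 O) = 0 -> bx H v (unit2 O) = 0 -> bx H v (unit3 O) = 0 -> v = 0
  := @albert_nondegenerate _ _ A.

Lemma dt_rel_det l m e u : phased_unitary H l e -> phased_unitary H m u ->
  dt_rel (to_mx e) (to_mx u) = det u / det e.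
Proof.
move=> Ue Uu; rewrite /dt_rel; set S := [set d | _].
have SE d : S d -> d = det u / det e.
  move=> [alpha [v [D ->]]].
  by rewrite -(dt_decomposition_det Ue D) mulfK // (det_neq0 Ue).
(* The set is inhabited, so [xget] returns one of its members and not the default 0. *)
apply: SE; have [v1 [v2 [v3 [a [b [c [F eE uE [aa bb cc]]]]]]]] := exists_frame HF HN Ue Uu.
have ll : l * l^* = 1 by case: Ue.
have [alpha [v D]] := frame_dt_decomposition ll F aa bb cc.
by apply: (@xgetPex _ 0 S); exists (\prod_j alpha j), alpha, v; rewrite eE uE.
Qed.

Lemma aone_phased : phased_unitary H 1 (aone O).
Proof.
have -> : aone O = 1 *: unit1 O + 1 *: unit2 O + 1 *: unit3 O.
  by rewrite /aone /unit1 /unit2 /unit3 !hrmZ !hrmD !scaler0 !mulr0 !mulr1 !addr0 !add0r.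
by apply: (frame_phased HF); rewrite !(mulr1, mul1r, rmorph1).
Qed.

End HermitianMatrices.

Theorem theorem4p2 (R : realType) (u e : 'M[octonion R]_3)
  (hu : unitary u) (he : unitary e) :
  dt u = dt_rel e u * dt e.
Proof.
have [[/C6_to_mx [u' uE] _] [/C6_to_mx [e' eE] _]] := (hu, he).
have HF := albert_frame (octonion_composition R).
have [m Uu] : exists m, phased_unitary (albert_hcubic (octonion_composition R)) m u'.
  by apply: (unitary_phased HF); apply: unitary_to_mx; rewrite -uE.
have [l Ue] : exists l, phased_unitary (albert_hcubic (octonion_composition R)) l e'.
  by apply: (unitary_phased HF); apply: unitary_to_mx; rewrite -eE.
have U1 := aone_phased R.
rewrite /dt uE eE -to_mx_one (dt_rel_det U1 Uu) (dt_rel_det Ue Uu) (dt_rel_det U1 Ue).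
by rewrite mulrA divfK // (det_neq0 Ue).
Qed.
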